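(* Let $r$ be a positive integer such that $r+1$ is a prime that is not a Mersenne prime (i.e. $r+2$ is not a power of $2$). Suppose there exist a positive integer $N$ and distinct primes $p_1,p_2$ with $\operatorname{ord}_{p_1}(r+1)=\operatorname{ord}_{p_2}(r+1)=2^N$. Then there are infinitely many primes $p$ such that $(r+1)^{\alpha}p\in G_r$ for all nonnegative integers $\alpha$.
   Context: For a positive integer $r$, the $r$-th Schemmel totient function $S_r:\mathbb{N}\to\mathbb{N}_0$ is the multiplicative arithmetic function (so $S_r(1)=1$ and $S_r(ab)=S_r(a)S_r(b)$ for coprime $a,b$) defined on prime powers by $S_r(p^{\alpha})=0$ if $p\le r$ and $S_r(p^\alpha)=p^{\alpha-1}(p-r)$ if $p>r$, for all primes $p$ and positive integers $\alpha$. $G_r$ denotes the set of positive integers not in the range of $S_r$. $\operatorname{ord}_q(a)$ denotes the multiplicative order of $a$ modulo the prime $q$. *)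

(* Defs.v *)
From mathcomp Require Import all_boot.
Set Implicit Arguments. Unset Strict Implicit. Unset Printing Implicit Defensive.

(* r-th Schemmel totient, multiplicative: on p^a (a>0) it is 0 if p <= r,
   else p^(a-1) (p - r).  For n = 1 (no prime factors) the product is 1.
   Only meaningful for n > 0 (domain is the positive integers). *)
Definition schemmel (r n : nat) : nat :=
  \prod_(p <- primes n) (if p <= r then 0 else p ^ (logn p n).-1 * (p - r)).

Definition in_G (r m : nat) : Prop :=
  0 < m /\ ~ (exists n, 0 < n /\ schemmel r n = m).

Definition is_ord (q a k : nat) : Prop :=
  0 < k /\ a ^ k = 1 %[mod q] /\ (forall j, 0 < j -> a ^ j = 1 %[mod q] -> k <= j).

(* Main.v *)
Require Import Defs.
From mathcomp Require Import all_boot.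
From mathcomp Require Import all_order all_algebra all_fingroup.
From mathcomp Require Import boolp classical_sets reals sequences exp Rstruct.
From mathcomp Require Import ring lra zify.
Set Implicit Arguments. Unset Strict Implicit. Unset Printing Implicit Defensive.
Import Order.TTheory GRing.Theory Num.Theory.

(** Write [q = r + 1]. If [S_r(n) = q ^ alpha * p] with [p > q] prime, the prime factor of [n] that
    brings in [p] forces [p = q ^ c + r] or [q ^ c * p + r] prime for some [c]. The first is excluded
    by [p = -1] modulo [q ^ 2]. For the second, choose for each [i < N] an odd prime dividing
    [q ^ (2 ^ i) + 1] ([p1] for [i = N - 1]); whenever [2 ^ N] does not divide [c + 1], one of them
    divides [q ^ c.+1 + 1], and hence [q ^ c * p + r] provided [p = r q] modulo all of them. The
    second prime [p2] of order [2 ^ N] takes care of the remaining [c] through [p = - r q].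

    Primes in this residue class modulo [m] come from Dirichlet's theorem, proved without complex
    characters. On real functions on the unit group [G], [L f (g) = sum_n f (g n) / n] is a normal
    operator, so functions of zero sum split as [ker L + im L]. With
    [T_N f = sum_(n <= N) Lambda(n) f(n) / n] one has [T_N = O(1)] on [im L] and, by Moebius
    inversion, [T_N f = - f(1) ln N + O(1)] on [ker L]. As [T_N] is nonnegative on the indicator of
    [1], the reproducing kernel [e] of [ker L] has [e(1) <= 1 / #|G|], so the functions in [ker L]
    have constant absolute value, and a nonzero one is a multiple of a quadratic character [chi] with
    [L(1, chi) = 0]. Monsky's Lambert series argument excludes it. Hence [ker L = 0] and [T_N] is
    asymptotically equidistributed over the residue classes. *)

Local Open Scope ring_scope.

(** * Divisor sums, Moebius and von Mangoldt functions *)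

Section DivisorSums.
Variable V : nmodType.

Lemma sum_multiples (H : nat -> V) d N : (0 < d)%N ->
  \sum_(1 <= n < N.+1 | (d %| n)%N) H (n %/ d)%N
  = \sum_(1 <= k < (N %/ d).+1) H k.
Proof.
move=> d0; elim: N => [|N IH]; first by rewrite div0n !big_geq.
rewrite big_mkcond big_nat_recr //= -big_mkcond /= IH divnS //.
case: (d %| N.+1)%N; last by rewrite addr0.
by rewrite add1n [RHS]big_nat_recr.
Qed.

(** Reordering by [n = d * k] with [d * k <= N]; the convolutions below are expanded this way. *)
Lemma sum_divisor_pairs (F : nat -> nat -> V) N :
  \sum_(1 <= n < N.+1) \sum_(1 <= d < n.+1 | (d %| n)%N) F d (n %/ d)%N
  = \sum_(1 <= d < N.+1) \sum_(1 <= k < (N %/ d).+1) F d k.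
Proof.
transitivity (\sum_(1 <= n < N.+1) \sum_(1 <= d < N.+1 | (d %| n)%N) F d (n %/ d)%N).
  apply: eq_big_nat => n /andP[n0 nN].
  rewrite (@big_nat_widen _ _ _ 1 n.+1 N.+1) //.
  apply: eq_bigl => d; rewrite ltnS.
  by case dvd: (d %| n)%N => //=; rewrite dvdn_leq.
under eq_bigr do rewrite big_mkcond /=.
rewrite exchange_big /=; apply: eq_big_nat => d /andP[d0 _].
by rewrite -big_mkcond sum_multiples.
Qed.

Lemma sum_divisors_dvd (H : nat -> V) n u : (0 < n)%N -> (u %| n)%N ->
  \sum_(1 <= d < n.+1 | (d %| u)%N) H d = \sum_(1 <= d < u.+1 | (d %| u)%N) H d.
Proof.
move=> n0 un; have u0 : (0 < u)%N by apply: dvdn_gt0 un.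
have un' := dvdn_leq n0 un; rewrite [RHS](@big_nat_widen _ _ _ 1 u.+1 n.+1) //.
apply: eq_bigl => d; rewrite ltnS; case dvd: (d %| u)%N => //=.
by rewrite dvdn_leq.
Qed.

Lemma sum_divisors_multiple (H : nat -> V) p n : (0 < n)%N -> (0 < p)%N -> (p %| n)%N ->
  \sum_(1 <= d < n.+1 | (d %| n)%N && (p %| d)%N) H d
  = \sum_(1 <= e < (n %/ p).+1 | (e %| n %/ p)%N) H (p * e)%N.
Proof.
move=> n0 p0 pn.
pose K e := if (e %| n %/ p)%N then H (p * e)%N else 0.
rewrite [RHS]big_mkcond /= -(sum_multiples K n p0).
rewrite /K -big_mkcondr; apply: eq_big => [d|d /andP[_ pd]].
  rewrite andbC; case pd: (p %| d)%N => //=.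
  have [e ->] := dvdnP pd; have [n' ->] := dvdnP pn.
  by rewrite !mulnK // dvdn_pmul2r.
by rewrite mulnC divnK.
Qed.
End DivisorSums.

Lemma dvdn_part_coprime p n d : prime p -> (0 < n)%N ->
  ((d %| n) && ~~ (p %| d))%N = (d %| n`_p^')%N.
Proof.
move=> pp n0; apply/andP/idP => [[dn pd]|dn].
  rewrite -(part_pnat_id (pi := p^') (n := d)) ?partn_dvd //.
  rewrite p'natE // (dvdn_gt0 n0 dn) //.
split; first by rewrite (dvdn_trans dn) // dvdn_part.
apply/negP => /dvdn_trans/(_ dn) H.
have := part_pnat p^' n; rewrite p'natE ?part_gt0 //; by rewrite H.
Qed.

Section Arithmetic.
Variable R : realType.
Implicit Types (n d p : nat).

Definition mobius n : R := \prod_(p <- primes n) (if logn p n == 1 then -1 else 0).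

Definition mangoldt n : R := if primes n is [:: p] then ln p%:R else 0.

Lemma mobius1 : mobius 1 = 1. Proof. by rewrite /mobius big_nil. Qed.

Lemma normr_mobius n : `|mobius n| <= 1.
Proof.
rewrite /mobius; elim: (primes n) => [|p s IH]; first by rewrite big_nil normr1.
rewrite big_cons normrM mulr_ile1 ?normr_ge0 //.
by case: ifP; rewrite ?normrN ?normr1 // normr0 ler01.
Qed.

Lemma mobiusM_prime p d : prime p -> (0 < d)%N ->
  mobius (p * d) = if (p %| d)%N then 0 else - mobius d.
Proof.
move=> pp d0; have p0 := prime_gt0 pp.
have pd0 : (0 < p * d)%N by rewrite muln_gt0 p0.
have lognp : logn p (p * d) = (logn p d).+1 by rewrite lognM // logn_prime // eqxx.
case: ifP => pd.
  rewrite /mobius (bigD1_seq p) ?primes_uniq //=; last by rewrite mem_primes pp pd0 dvdn_mulr.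
  by rewrite lognp eqSS -leqn0 leqNgt logn_gt0 mem_primes pp d0 pd mul0r.
have perm : perm_eq (primes (p * d)) (p :: primes d).
  apply: uniq_perm; rewrite ?primes_uniq //= ?primes_uniq ?mem_primes ?pd ?andbF //.
  by move=> x; rewrite primesM // inE primes_prime // inE.
rewrite /mobius (perm_big _ perm) big_cons /= lognp.
have -> : logn p d = 0%N by apply/eqP; rewrite -leqn0 leqNgt logn_gt0 mem_primes pp d0 pd.
rewrite eqxx mulN1r; congr (- _); apply: eq_big_seq => x xd.
have xp : x != p by apply: contraTneq xd => ->; rewrite mem_primes pd !andbF.
by rewrite lognM // logn_prime // (negbTE xp).
Qed.

(** Each [d] prime to [p] is paired with [p * d], where [mobius (p * d) = - mobius d]; divisors
    containing [p] twice contribute [0]. With [g] constant or [g = ln] this yields both Moebius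
    identities. *)
Lemma sum_mobius_prime (g : nat -> R) p n : prime p -> (0 < n)%N -> (p %| n)%N ->
  \sum_(1 <= d < n.+1 | (d %| n)%N) mobius d * g d
  = \sum_(1 <= d < (n`_p^').+1 | (d %| n`_p^')%N) mobius d * (g d - g (p * d)%N).
Proof.
move=> pp n0 pn; have p0 := prime_gt0 pp.
rewrite (bigID (fun d => (p %| d)%N)) /= sum_divisors_multiple //.
have -> : \sum_(1 <= e < (n %/ p).+1 | (e %| n %/ p)%N) mobius (p * e) * g (p * e)%N
  = - \sum_(1 <= d < n.+1 | (d %| n`_p^')%N) mobius d * g (p * d)%N.
  have [n' en] := dvdnP pn; move: (n0); rewrite en mulnK // => n'0.
  have n'0' : (0 < n')%N by move: n'0; rewrite muln_gt0 => /andP[].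
  have -> : ((n' * p)`_p^' = n'`_p^')%N.
    by rewrite partnM // (part_p'nat (n := p)) ?muln1 // pnatNK pnat_id.
  pose H d := mobius d * g (p * d)%N.
  rewrite (@sum_divisors_dvd _ H (n' * p)) ?(dvdn_trans (dvdn_part _ _)) ?dvdn_mulr //.
  rewrite -(@sum_divisors_dvd _ H n') ?dvdn_part // /H -sumrN.
  rewrite big_mkcond [RHS]big_mkcond; apply: eq_big_nat => d /andP[d0 _].
  rewrite -(dvdn_part_coprime _ pp n'0') mobiusM_prime //.
  by case: (d %| n')%N => //=; case: (p %| d)%N; rewrite /= ?mul0r // mulNr.
rewrite addrC; under eq_bigl do rewrite dvdn_part_coprime //.
by rewrite -sumrB sum_divisors_dvd ?dvdn_part //; apply: eq_bigr => d _; rewrite mulrBr.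
Qed.

Lemma sum_mobius n : (0 < n)%N ->
  \sum_(1 <= d < n.+1 | (d %| n)%N) mobius d = (n == 1)%:R.
Proof.
move=> n0; have [->|n1] := eqVneq n 1%N.
  by rewrite big_mkcond big_nat1 mobius1.
have n2 : (1 < n)%N by rewrite ltn_neqAle eq_sym n1.
under eq_bigr do rewrite -[mobius _]mulr1.
rewrite (sum_mobius_prime (fun=> 1) (pdiv_prime n2)) ?pdiv_dvd //.
by apply: big1 => d _; rewrite subrr mulr0.
Qed.

Lemma primes_pdiv_part n : (1 < n)%N ->
  mangoldt n = (n`_(pdiv n)^' == 1)%N%:R * ln (pdiv n)%:R.
Proof.
move=> n2; have n0 := ltnW n2.
have pp := pdiv_prime n2; set p := pdiv n.
rewrite partn_eq1 // pnatNK.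
have pn : p \in primes n by rewrite mem_primes pp n0 pdiv_dvd.
have [pnat|npnat] := boolP (p.-nat n).
  rewrite mul1r /mangoldt.
  have e : n = (p ^ logn p n)%N by rewrite -p_part part_pnat_id.
  rewrite e primesX ?primes_prime //.
  by rewrite logn_gt0.
rewrite mul0r /mangoldt; case E: (primes n) => [|x [|y s]] //.
exfalso; move/negP: npnat; apply; apply/pnatP => // l lp ln.
have : l \in primes n by rewrite mem_primes lp n0.
by move: pn; rewrite E !inE => /eqP -> /eqP ->.
Qed.

(** For [p = pdiv n] the difference [ln d - ln (p * d)] is the constant [- ln p], so only
    [sum_mobius] of the part of [n] prime to [p] remains. *)
Lemma sum_mobius_ln n : (0 < n)%N ->
  \sum_(1 <= d < n.+1 | (d %| n)%N) mobius d * ln d%:R = - mangoldt n.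
Proof.
move=> n0; have [->|n1] := eqVneq n 1%N.
  by rewrite big_mkcond big_nat1 /= ln1 mulr0 /mangoldt /= oppr0.
have n2 : (1 < n)%N by rewrite ltn_neqAle eq_sym n1.
have pp := pdiv_prime n2.
rewrite (sum_mobius_prime (fun d => ln d%:R) pp) ?pdiv_dvd //.
rewrite primes_pdiv_part // -sum_mobius ?part_gt0 // -mulNr -sumrN mulr_suml.
rewrite big_mkcond [RHS]big_mkcond; apply: eq_big_nat => d /andP[d0 _].
case: ifP => // _; rewrite natrM lnM ?posrE ?ltr0n ?(prime_gt0 pp) //.
by ring.
Qed.

Lemma mangoldt_ge0 n : 0 <= mangoldt n.
Proof.
rewrite /mangoldt; case E: (primes n) => [|x [|y s]] //.
have : x \in primes n by rewrite E inE.
by rewrite mem_primes => /and3P[xp _ _]; rewrite ln_ge0 // ler1n prime_gt0.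
Qed.

Lemma mangoldt1 : mangoldt 1 = 0. Proof. by []. Qed.

Lemma mangoldt_primeX p k : prime p -> (0 < k)%N -> mangoldt (p ^ k) = ln p%:R.
Proof. by move=> pp k0; rewrite /mangoldt primesX // primes_prime. Qed.

Lemma mangoldt_neq0 n : mangoldt n != 0 -> exists2 p, prime p & exists2 k, (0 < k)%N & n = (p ^ k)%N.
Proof.
have [n0|n2] := leqP n 1; first by case: n n0 => [|[]] //; rewrite /mangoldt eqxx.
rewrite primes_pdiv_part // => h; exists (pdiv n); first exact: pdiv_prime.
have n0 := ltnW n2.
exists (logn (pdiv n) n); first by rewrite logn_gt0 mem_primes pdiv_prime // n0 pdiv_dvd.
move: h; rewrite partn_eq1 // pnatNK; case: (boolP (_.-nat _)) => [h _|]; last by rewrite mul0r eqxx.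
by rewrite -p_part part_pnat_id.
Qed.

(** Induction on [n = n' * p]: a prime power dividing [n] but not [n'] can only be the full power of
    [p] in [n]. *)
Lemma sum_mangoldt n : (0 < n)%N ->
  \sum_(1 <= d < n.+1 | (d %| n)%N) mangoldt d = ln n%:R.
Proof.
elim/ltn_ind: n => n IH n0.
have [->|n1] := eqVneq n 1%N; first by rewrite big_mkcond big_nat1 /= mangoldt1 ln1.
have n2 : (1 < n)%N by rewrite ltn_neqAle eq_sym n1.
move: (pdiv_prime n2) (pdiv_dvd n); move: (pdiv n) => p pp pn.
have p0 := prime_gt0 pp.
have [n' en] := dvdnP pn.
have n'0 : (0 < n')%N by move: n0; rewrite en muln_gt0 => /andP[].
have n'n : (n' < n)%N by rewrite en ltn_Pmulr // prime_gt1.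
rewrite [in RHS]en natrM lnM ?posrE ?ltr0n // -(IH _ n'n n'0).
rewrite (bigID (fun d => (d %| n')%N)) /=; congr (_ + _).
  rewrite -(sum_divisors_dvd _ n0) ?en ?dvdn_mulr //.
  apply: eq_bigl => d; case h: (d %| n')%N; rewrite ?andbF // andbT.
  by rewrite dvdn_mulr.
set k := logn p n.
have k0 : (0 < k)%N by rewrite logn_gt0 mem_primes pp n0 pn.
have kn' : logn p n' = k.-1 by rewrite /k en lognM // (logn_prime p pp) eqxx addn1.
rewrite big_mkcond (bigD1_seq (p ^ k)%N) ?iota_uniq //=; last first.
  by rewrite mem_index_iota expn_gt0 p0 /= ltnS dvdn_leq // pfactor_dvdnn.
rewrite ifT; last first.
  by rewrite !pfactor_dvdn // kn' -/k leqnn -ltnNge prednK /=.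
rewrite mangoldt_primeX //= big1 ?addr0 //.
move=> d dk; case: ifP => // /andP[dn dn'].
apply: contraNeq dn' => /mangoldt_neq0.
move=> [l lp [j j0 ed]]; subst d.
have [el|nel] := eqVneq l p.
  subst l; move: dn dk; rewrite !pfactor_dvdn // kn' -/k.
  rewrite leq_eqVlt => /orP[/eqP ->|]; first by rewrite eqxx.
  by move=> jk _; rewrite -ltnS prednK.
move: dn; rewrite en Gauss_dvdl // coprimeXl // prime_coprime // dvdn_prime2 //.
Qed.

(** With [x = ln N] this is the weight used on the kernel of [L]: it produces [mangoldt] plus one
    main term at [n = 1]. *)
Lemma mobius_selberg_weight n (x : R) : (0 < n)%N ->
  \sum_(1 <= d < n.+1 | (d %| n)%N) mobius d * (x - ln d%:R)
  = mangoldt n + (n == 1)%:R * x.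
Proof.
move=> n0; under eq_bigr do rewrite mulrBr.
rewrite sumrB sum_mobius_ln // opprK addrC -mulr_suml sum_mobius //.
Qed.
End Arithmetic.

(** * Chebyshev and Mertens estimates *)

Section Chebyshev.
Variable R : realType.
Implicit Types (n d p k N : nat).
Local Notation mangoldt := (mangoldt R).
Local Notation mobius := (mobius R).

Lemma ln_nat_ge0 n : 0 <= ln n%:R :> R.
Proof.
by case: n => [|n]; [rewrite ln0 | rewrite ln_ge0 // ler1n].
Qed.

Lemma ln_natS n : (0 < n)%N -> ln n.+1%:R - ln n%:R <= n%:R^-1 :> R.
Proof.
move=> n0; have n0' : 0 < n%:R :> R by rewrite ltr0n.
rewrite -ln_div ?posrE ?ltr0n //.
have -> : n.+1%:R / n%:R = 1 + n%:R^-1 :> R by rewrite -addn1 natrD; field; rewrite gt_eqF.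
by apply: le_ln1Dx; rewrite (lt_trans _ (y := 0)) ?invr_gt0 // oppr_lt0 ltr01.
Qed.

Lemma ln_factorial N : ln N`!%:R = \sum_(1 <= n < N.+1) ln n%:R :> R.
Proof.
elim: N => [|N IH]; first by rewrite big_geq // ln1.
by rewrite big_nat_recr //= factS mulnC natrM lnM ?posrE ?ltr0n ?fact_gt0 // IH.
Qed.

Lemma ln_factorial_mangoldt N :
  ln N`!%:R = \sum_(1 <= d < N.+1) mangoldt d * (N %/ d)%:R.
Proof.
rewrite ln_factorial; transitivity
  (\sum_(1 <= n < N.+1) \sum_(1 <= d < n.+1 | (d %| n)%N) mangoldt d).
  by apply: eq_big_nat => n /andP[n0 _]; rewrite sum_mangoldt.
rewrite (sum_divisor_pairs (fun d _ => mangoldt d)).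
by apply: eq_bigr => d _; rewrite sumr_const_nat subn1 /= mulr_natr.
Qed.

Lemma ln_factorial_le N : ln N`!%:R <= N%:R * ln N%:R :> R.
Proof.
have -> : N%:R * ln N%:R = \sum_(1 <= n < N.+1) ln N%:R :> R.
  by rewrite sumr_const_nat subn1 mulr_natl.
rewrite ln_factorial big_nat [leRHS]big_nat.
apply: ler_sum => n /andP[n0 nN]; rewrite ler_ln ?posrE ?ltr0n ?ler_nat //.
exact: leq_trans n0 nN.
Qed.

(** A crude Stirling bound, by induction from [n * (ln n.+1 - ln n) <= 1]. *)
Lemma ln_factorial_ge N : N%:R * ln N%:R - N%:R <= ln N`!%:R :> R.
Proof.
elim: N => [|N IH]; first by rewrite mul0r subr0 ln1.
case: N IH => [|N] IH; first by rewrite ln1 mulr0 sub0r oppr_le0.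
rewrite factS mulnC natrM lnM ?posrE ?ltr0n ?fact_gt0 //.
have := @ln_natS N.+1 isT.
have n0 : 0 < N.+1%:R :> R by rewrite ltr0n.
rewrite -(ler_pM2l n0) divff ?gt_eqF // mulrBr => h.
rewrite -[X in X * _ - X]natr1; move: IH h; lra.
Qed.

Definition psi N : R := \sum_(1 <= d < N.+1) mangoldt d.

Lemma psi_mono k n : (k <= n)%N -> psi k <= psi n.
Proof.
move=> kn; rewrite /psi (@big_cat_nat _ _ _ k.+1 1 n.+1) //= lerDl.
by apply: sumr_ge0 => i _; apply: mangoldt_ge0.
Qed.

Lemma bin_le_exp2 n k : ('C(n, k) <= 2 ^ n)%N.
Proof.
have [kn|nk] := leqP k n; last by rewrite bin_small.
rewrite -[2%N]/(1 + 1)%N expnDn (bigD1 (Ordinal (kn : (k < n.+1)%N))) //=.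
by rewrite !exp1n !muln1 leq_addr.
Qed.

(** Chebyshev's argument: [k.*2 %/ d >= 2 * (k %/ d)] for [d <= k] and [k.*2 %/ d >= 1] for
    [k < d <= k.*2], so the increment of [psi] is at most the logarithm of the central binomial
    coefficient, which is below [2 ^ k.*2]. *)
Lemma psi_double k : psi k.*2 <= psi k + k.*2%:R.
Proof.
have kk : (k <= k.*2)%N by rewrite -addnn leq_addr.
have h1 : 2 * ln k`!%:R + (psi k.*2 - psi k) <= ln (k.*2)`!%:R :> R.
  rewrite !ln_factorial_mangoldt /psi (@big_cat_nat _ _ _ k.+1 1 k.*2.+1) //=.
  rewrite [X in _ <= X](@big_cat_nat _ _ _ k.+1 1 k.*2.+1) //=.
  rewrite [X in _ + (X - _)]addrC addrK mulr_sumr; apply: lerD.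
    apply: ler_sum => d _; rewrite mulrCA ler_wpM2l ?mangoldt_ge0 //.
    rewrite -natrM ler_nat -muln2 mulnC.
    by have [->|d0] := posnP d; rewrite ?divn0 // leq_divRL // mulnAC leq_mul // leq_divM.
  rewrite big_nat [leRHS]big_nat; apply: ler_sum => d /andP[kd dk].
  rewrite ler_peMr ?mangoldt_ge0 // ler1n divn_gt0 //; exact: leq_trans kd.
have h2 : ln (k.*2)`!%:R <= 2 * ln k`!%:R + k.*2%:R :> R.
  have e : ('C(k.*2, k) * (k`! * k`!) = (k.*2)`!)%N.
    by rewrite -(bin_fact kk) -addnn addnK.
  have c0 : (0 < 'C(k.*2, k))%N by rewrite bin_gt0.
  rewrite -e !natrM !lnM ?posrE ?mulr_gt0 ?ltr0n ?fact_gt0 //.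
  suff : ln ('C(k.*2, k))%:R <= k.*2%:R :> R by lra.
  apply: (@le_trans _ _ (ln (2 ^ k.*2)%:R)).
    by rewrite ler_ln ?posrE ?ltr0n ?expn_gt0 // ler_nat bin_le_exp2.
  rewrite natrX lnXn // -[ln _ *+ _]mulr_natl ler_piMr //.
  have := @le_ln1Dx R 1; apply; lra.
lra.
Qed.

(** Strong induction by halving; the constant [4] absorbs the rounding, as [6 * uphalf n <= 4 * n]
    for [n >= 2]. *)
Lemma psi_le N : psi N <= 4 * N%:R.
Proof.
elim/ltn_ind: N => N IH; case: N IH => [|[|N]] IH.
- by rewrite /psi big_geq // mulr0.
- by rewrite /psi big_nat1 mangoldt1 mulr1.
have kN : (uphalf N.+2 < N.+2)%N by rewrite /= ltnS uphalf_half; lia.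
have Nk : (N.+2 <= (uphalf N.+2).*2)%N by rewrite uphalf_half; lia.
apply: le_trans (psi_mono Nk) _; apply: le_trans (psi_double _) _.
apply: (@le_trans _ _ (4 * (uphalf N.+2)%:R + ((uphalf N.+2).*2)%:R)).
  by rewrite lerD2r IH.
rewrite -!natrM -natrD ler_nat uphalf_half; lia.
Qed.

(** Legendre's formula for [ln N!] with [N %/ d] replaced by the larger [N / d]; in the reverse
    bound the replacement costs at most [psi N]. *)
Lemma mertens_ge N : (0 < N)%N -> ln N%:R - 1 <= \sum_(1 <= d < N.+1) mangoldt d / d%:R.
Proof.
move=> N0; have N0' : 0 < N%:R :> R by rewrite ltr0n.
rewrite -(ler_pM2l N0') mulrBr mulr1; apply: le_trans (ln_factorial_ge N) _.
rewrite ln_factorial_mangoldt mulr_sumr big_nat [leRHS]big_nat.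
apply: ler_sum => d /andP[d0 _]; rewrite mulrCA ler_wpM2l ?mangoldt_ge0 //.
by rewrite ler_pdivlMr ?ltr0n // -natrM ler_nat leq_divM.
Qed.

Lemma mertens_le N : (0 < N)%N -> \sum_(1 <= d < N.+1) mangoldt d / d%:R <= ln N%:R + 4.
Proof.
move=> N0; have N0' : 0 < N%:R :> R by rewrite ltr0n.
rewrite -(ler_pM2l N0') mulrDr.
apply: (@le_trans _ _ (ln N`!%:R + psi N)); last first.
  by rewrite lerD ?ln_factorial_le // mulrC psi_le.
rewrite ln_factorial_mangoldt /psi -big_split /= mulr_sumr.
rewrite [leLHS]big_nat [leRHS]big_nat.
apply: ler_sum => d /andP[d0 _].
rewrite mulrCA -[X in _ <= _ + X]mulr1 -mulrDr ler_wpM2l ?mangoldt_ge0 //.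
rewrite ler_pdivrMr ?ltr0n // natr1 -natrM ler_nat ltnW // ltn_ceil //.
Qed.

(** A geometric series, by recursion from [N] to [N %/ p]: a power of [p] other than [1] is [p]
    times a power of [p]. *)
Lemma sum_inv_pnat p N : prime p ->
  \sum_(1 <= k < N.+1 | p.-nat k) k%:R^-1 <= p%:R / (p%:R - 1) :> R.
Proof.
move=> pp; have p0 := prime_gt0 pp.
have p1 : 1 < p%:R :> R by rewrite ltr1n prime_gt1.
elim/ltn_ind: N => -[|N] IH.
  by rewrite big_geq // divr_ge0 ?ler0n // subr_ge0 ltW.
have NpN : (N.+1 %/ p < N.+1)%N by rewrite ltn_Pdiv // prime_gt1.
apply: (@le_trans _ _ (1 + \sum_(1 <= k < N.+2 | (p %| k)%N && p.-nat k) k%:R^-1)).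
  rewrite (bigID (fun k => (p %| k)%N)) /= addrC; apply: lerD; last first.
    by under eq_bigl do rewrite andbC.
  rewrite big_mkcond /= big_ltn // [X in _ + X]big1_seq ?addr0.
    by case: ifP => _; rewrite ?invr1 ?ler01.
  move=> k /andP[_]; rewrite mem_index_iota => /andP[k2 _].
  case: ifP => // /andP[pk /negP[]].
  have := pdiv_prime k2; move/(pnatP _ (ltnW k2)): pk => h /h; rewrite pdiv_dvd => /(_ isT).
  by rewrite inE /= => /eqP <-; exact: pdiv_dvd.
rewrite big_mkcondr /=.
pose H k : R := if p.-nat (p * k)%N then (p * k)%:R^-1 else 0.
have -> : \sum_(1 <= k < N.+2 | (p %| k)%N) (if p.-nat k then k%:R^-1 else 0 : R)
  = \sum_(1 <= k < N.+2 | (p %| k)%N) H (k %/ p)%N.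
  by apply: eq_bigr => k pk; rewrite /H mulnC divnK.
rewrite sum_multiples // /H.
have -> : \sum_(1 <= k < (N.+1 %/ p).+1) (if p.-nat (p * k)%N then (p * k)%:R^-1 else 0 : R)
  = p%:R^-1 * \sum_(1 <= k < (N.+1 %/ p).+1 | p.-nat k) k%:R^-1.
  rewrite [in RHS]big_mkcond mulr_sumr; apply: eq_bigr => k _.
  rewrite pnatM (pnat_id pp) /=; case: ifP; rewrite ?mulr0 //.
  by rewrite natrM invfM.
have p1' : 0 < p%:R - 1 :> R by rewrite subr_gt0.
have p0' : 0 < p%:R :> R by rewrite ltr0n.
apply: (@le_trans _ _ (1 + p%:R^-1 * (p%:R / (p%:R - 1)))).
  by rewrite lerD2l ler_wpM2l ?invr_ge0 ?ler0n // IH.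
by rewrite le_eqVlt; apply/orP; left; apply/eqP; field; rewrite !gt_eqF.
Qed.

Lemma sum_ln_over_square N :
  \sum_(2 <= p < N.+1) ln p%:R / (p%:R * (p%:R - 1)) <= 2 :> R.
Proof.
case: N => [|N]; first by rewrite big_geq.
(* Telescoping majorant: the term at [n.+1] is at most [G n - G n.+1], and [G 1 = 2]. *)
pose G n : R := (ln n%:R + 2) / n%:R.
apply: (@le_trans _ _ (G 1%N - G N.+1)); last first.
  rewrite /G ln1 add0r divr1 lerBlDr lerDl divr_ge0 ?ler0n // addr_ge0 ?ln_nat_ge0 //.
elim: N => [|N IH]; first by rewrite big_geq // subrr.
rewrite big_nat_recr //=.
apply: (@le_trans _ _ (G 1%N - G N.+1 + (G N.+1 - G N.+2))); last by lra.
apply: lerD => //; rewrite /G.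
have := @ln_natS N.+1 isT; rewrite -(natr1 N.+1).
have: 1 <= N.+1%:R :> R by rewrite ler1n.
set x : R := N.+1%:R; set u : R := ln (x + 1); set v : R := ln x => x1 h.
have x0 : 0 < x by lra.
rewrite -(ler_pM2l x0) divff ?gt_eqF // in h.
rewrite addrK -subr_ge0.
have -> : (v + 2) / x - (u + 2) / (x + 1) - u / ((x + 1) * x)
  = ((v + 2) * (x + 1) - (u + 2) * x - u) / (x * (x + 1)).
  by field; rewrite !gt_eqF //; lra.
apply: divr_ge0; last by apply: mulr_ge0; lra.
have xx : x * (u - v) <= x by lra.
have : u - v <= 1 by rewrite -(ler_pM2l x0) mulr1.
lra.
Qed.

(** Proper powers of [p] are divisible by [p ^ 2], so their total is at most [ln p / (p * (p - 1))].
    Hence an unbounded [mangoldt] sum must come from primes. *)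
Lemma sum_mangoldt_nonprime N :
  \sum_(1 <= n < N.+1 | ~~ prime n) mangoldt n / n%:R <= 2.
Proof.
apply: le_trans (sum_ln_over_square N).
apply: (@le_trans _ _ (\sum_(1 <= n < N.+1 | ~~ prime n)
   \sum_(2 <= p < N.+1 | [&& prime p, p %| n & p.-nat n]%N) ln p%:R / n%:R)).
  rewrite big_nat_cond [leRHS]big_nat_cond.
  apply: ler_sum => n /andP[/andP[n0 nN] npn].
  have pos (P : pred nat) : 0 <= \sum_(2 <= p < N.+1 | P p) ln p%:R / n%:R :> R.
    by apply: sumr_ge0 => p _; rewrite divr_ge0 ?ler0n ?ln_nat_ge0.
  have [->|/mangoldt_neq0] := eqVneq (mangoldt n) 0; first by rewrite mul0r pos.
  move=> [p pp [k k0 en]].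
  have pn : (p %| n)%N by rewrite en dvdn_exp.
  rewrite big_mkcond (bigD1_seq p) ?iota_uniq //=; last first.
    by rewrite mem_index_iota prime_gt1 //= ltnS (leq_trans (dvdn_leq n0 pn)).
  have pnat : p.-nat n by rewrite en pnatX pnat_id.
  rewrite ifT ?pp ?pn ?pnat // {1}en mangoldt_primeX // lerDl.
  by apply: sumr_ge0 => l _; case: ifP => // _; rewrite divr_ge0 ?ler0n ?ln_nat_ge0.
rewrite (exchange_big_dep (fun p => prime p)) /=; last by move=> n p _ /and3P[].
rewrite big_mkcond /= big_nat [leRHS]big_nat; apply: ler_sum => p /andP[p2 _].
have p1 : 0 < p%:R - 1 :> R by rewrite subr_gt0 ltr1n.
have p0' : 0 < p%:R :> R by rewrite ltr0n ltnW.
have lnp := ln_nat_ge0 p.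
case: ifP => [pp|_]; last by rewrite divr_ge0 ?mulr_ge0 // ltW.
rewrite -mulr_sumr ler_wpM2l //.
apply: (@le_trans _ _ (\sum_(1 <= n < N.+1 | (p ^ 2 %| n)%N) (if p.-nat n then n%:R^-1 else 0))).
  rewrite big_mkcond [leRHS]big_mkcond big_nat [leRHS]big_nat; apply: ler_sum => n /andP[n0 _].
  rewrite pp /=; have inv0 : 0 <= n%:R^-1 :> R by rewrite invr_ge0 ler0n.
  case: ifP => [/and3P[npn pn pnat]|_]; last by case: ifP => // _; case: ifP.
  rewrite pnat ifT //.
  have en : n = (p ^ logn p n)%N by rewrite -p_part part_pnat_id.
  rewrite pfactor_dvdn // ltn_neqAle eq_sym logn_gt0 mem_primes pp n0 pn !andbT.
  by apply: contraNneq npn => e; rewrite en e expn1.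
pose H k : R := if p.-nat (p ^ 2 * k)%N then (p ^ 2 * k)%:R^-1 else 0.
have -> : \sum_(1 <= n < N.+1 | (p ^ 2 %| n)%N) (if p.-nat n then n%:R^-1 else 0)
  = \sum_(1 <= n < N.+1 | (p ^ 2 %| n)%N) H (n %/ p ^ 2)%N.
  by apply: eq_bigr => n pn; rewrite /H mulnC divnK.
rewrite sum_multiples ?expn_gt0 ?prime_gt0 // /H.
have -> : \sum_(1 <= k < (N %/ p ^ 2).+1) (if p.-nat (p ^ 2 * k)%N then (p ^ 2 * k)%:R^-1 else 0 : R)
  = p%:R ^- 2 * \sum_(1 <= k < (N %/ p ^ 2).+1 | p.-nat k) k%:R^-1.
  rewrite [in RHS]big_mkcond mulr_sumr; apply: eq_bigr => k _.
  rewrite pnatM pnatX (pnat_id pp) /=; case: ifP; rewrite ?mulr0 //.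
  by rewrite natrM natrX invfM.
have -> : (p%:R * (p%:R - 1))^-1 = p%:R ^- 2 * (p%:R / (p%:R - 1)) :> R.
  by field; rewrite !gt_eqF.
by rewrite ler_wpM2l ?invr_ge0 ?exprn_ge0 ?ler0n // sum_inv_pnat.
Qed.
End Chebyshev.

(** * Partial summation, limits and normal matrices *)

Section Sequences.
Variable R : realType.

(** Abel summation against a decreasing nonnegative weight. *)
Lemma norm_sum_monotone (f b : nat -> R) (K : R) i j :
  (forall k, (i <= k)%N -> `|\sum_(i <= n < k) f n| <= K) ->
  (forall n, (i <= n)%N -> b n.+1 <= b n) -> (forall n, (i <= n)%N -> 0 <= b n) ->
  `|\sum_(i <= n < j) f n * b n| <= K * b i.
Proof.
move=> fK bdec b0.
have K0 : 0 <= K by apply: le_trans (fK i _); rewrite ?normr_ge0.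
have [ji|ij] := leqP j i; first by rewrite big_geq // normr0 mulr_ge0 // b0.
have [d ->] : exists d, j = (i + d).+1 by exists (j - i.+1)%N; rewrite -addSn subnKC.
pose P k := \sum_(i <= n < k) f n.
(* With the boundary term subtracted the induction closes: each step adds at most [K] times one
   decrement of [b]. *)
suff h : `|\sum_(i <= n < (i + d).+1) f n * b n - P (i + d).+1 * b (i + d)%N| <= K * (b i - b (i + d)%N).
  have := fK (i + d).+1 (leq_trans (leq_addr d i) (leqnSn _)).
  have b0d := b0 _ (leq_addr d i); rewrite -/(P _) => hP.
  rewrite -[X in `|X|](subrK (P (i + d).+1 * b (i + d)%N)).
  apply: le_trans (ler_normD _ _) _.
  apply: (@le_trans _ _ (K * (b i - b (i + d)%N) + K * b (i + d)%N)); last by rewrite -mulrDr subrK.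
  by apply: lerD => //; rewrite normrM (ger0_norm b0d) ler_wpM2r.
elim: d => [|d IH].
  by rewrite addn0 /P !big_nat1 !subrr normr0 mulr0.
have id : (i <= i + d)%N by rewrite leq_addr.
rewrite addnS /P big_nat_recr ?leqW //= [in X in _ - X]big_nat_recr ?leqW //= -/(P _).
have -> : \sum_(i <= n < (i + d).+1) f n * b n + f (i + d).+1 * b (i + d).+1
   - (P (i + d).+1 + f (i + d).+1) * b (i + d).+1
  = (\sum_(i <= n < (i + d).+1) f n * b n - P (i + d).+1 * b (i + d)%N)
    + P (i + d).+1 * (b (i + d)%N - b (i + d).+1) by ring.
apply: le_trans (ler_normD _ _) _.
have -> : K * (b i - b (i + d).+1) = K * (b i - b (i + d)%N) + K * (b (i + d)%N - b (i + d).+1) by ring.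
apply: lerD => //; rewrite normrM [X in _ * X]ger0_norm ?subr_ge0 ?bdec //.
by rewrite ler_wpM2r ?subr_ge0 ?bdec // fK // leqW.
Qed.

(** The intervals [[u x - e x, u x + e x]] meet pairwise, and [l] is the supremum of their left
    ends. The error [e] is kept as an explicit rate. *)
Lemma limit_of_cauchy (u e : nat -> R) :
  (forall x y, (x <= y)%N -> `|u y - u x| <= e x) ->
  (forall x y, (x <= y)%N -> e y <= e x) ->
  exists l, forall x, `|u x - l| <= e x.
Proof.
move=> ue emono.
have uexy x y : u x - e x <= u y + e y.
  have [xy|/ltnW yx] := leqP x y.
    have := ue x y xy; rewrite ler_norml => /andP[h _].
    have : 0 <= e y by apply: le_trans (ue y y _); rewrite ?normr_ge0.
    lra.
  have := ue y x yx; rewrite ler_norml => /andP[_ h].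
  have : 0 <= e x by apply: le_trans (ue x x _); rewrite ?normr_ge0.
  lra.
pose S : set R := [set z | exists x, z = u x - e x]%classic.
have S0 : (S !=set0)%classic by exists (u 0%N - e 0%N); exists 0%N.
have Sub y : ubound S (u y + e y) by move=> _ [x ->]; apply: uexy.
have hS : has_sup S by split => //; exists (u 0%N + e 0%N); apply: Sub.
exists (sup S) => x; rewrite ler_norml.
have h1 : u x - e x <= sup S by apply: sup_upper_bound => //; exists x.
have h2 : sup S <= u x + e x by apply: ge_sup.
lra.
Qed.

Lemma natr_unbounded (x : R) : exists n : nat, (0 < n)%N /\ x < n%:R.
Proof.
exists (Num.truncn `|x|).+1; split=> //.
by apply: le_lt_trans (ler_norm x) _; apply: truncnS_gt.
Qed.

Lemma ln_unbounded (x : R) : exists n : nat, (0 < n)%N /\ x < ln n%:R.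
Proof.
have [n [n0 h]] := natr_unbounded (expR x); exists n; split=> //.
by rewrite -(expRK x) ltr_ln ?posrE ?expR_gt0 ?ltr0n.
Qed.
End Sequences.

Section NormalMatrix.
Variables (F : realFieldType) (n : nat) (A : 'M[F]_n).
Hypothesis normalA : A *m A^T = A^T *m A.

Lemma row_normsq_eq0 (w : 'rV[F]_n) : w *m w^T = 0 -> w = 0.
Proof.
move=> /matrixP/(_ 0 0); rewrite !mxE => h.
apply/rowP => i; rewrite !mxE; apply/eqP; rewrite -sqrf_eq0.
have h' : \sum_j w 0 j ^+ 2 = 0.
  by rewrite -[RHS]h; apply: eq_bigr => j _; rewrite mxE expr2.
by rewrite (psumr_eq0P _ h') // => j _; apply: sqr_ge0.
Qed.

Lemma normal_kernel_trmx (w : 'rV[F]_n) : w *m A = 0 -> w *m A^T = 0.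
Proof.
move=> wA; apply: row_normsq_eq0.
by rewrite trmx_mul trmxK -mulmxA (mulmxA A^T) -normalA !mulmxA wA !mul0mx.
Qed.

(** If [w = v *m A] and [w *m A = 0], then [w *m A^T = 0] by normality, so
    [w *m w^T = w *m A^T *m v^T = 0]. Kernel and image thus meet trivially, and rank-nullity does
    the rest. *)
Lemma normal_decomposition (u : 'rV[F]_n) :
  exists k h : 'rV[F]_n, u = k + h *m A /\ k *m A = 0.
Proof.
have dir : (kermx A :&: A)%MS = 0.
  apply/eqP/rowV0P => w; rewrite sub_capmx => /andP[/sub_kermxP wA /submxP[v ev]].
  have wAT := normal_kernel_trmx wA.
  apply: row_normsq_eq0; rewrite {2}ev trmx_mul mulmxA.
  by rewrite wAT mul0mx.
have full : (u <= kermx A + A)%MS.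
  apply: submx_full; rewrite /row_full.
  have := mxrank_sum_cap (kermx A) A; rewrite dir mxrank0 addn0 mxrank_ker => ->.
  by rewrite subnK // rank_leq_row.
have /sub_addsmxP[[k h] /= ->] := full.
exists (k *m kermx A), h; split=> //.
by rewrite -mulmxA mulmx_ker mulmx0.
Qed.
End NormalMatrix.

(** * Functions on the unit group *)

Section ResidueClasses.
Variables (R : realType) (m : nat).
Hypothesis m1 : (1 < m)%N.
Local Notation G := {unit 'Z_m}.
Local Notation mangoldt := (mangoldt R).
Local Notation mobius := (mobius R).
Implicit Types (f h v : G -> R) (g x : G) (n d N : nat).

(** Integers not prime to [m] get the default class [1], a value that [uext] masks. *)
Definition cls n : G := insubd (1%g : G) (n%:R : 'Z_m).

Lemma val_cls n : coprime m n -> val (cls n) = n%:R.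
Proof. by move=> mn; rewrite val_insubd unitZpE // mn. Qed.

Lemma clsM n d : coprime m n -> coprime m d -> cls (n * d)%N = (cls n * cls d)%g.
Proof.
by move=> mn md; apply: val_inj; rewrite val_cls ?coprimeMr ?mn //= !val_cls // natrM.
Qed.

Lemma cls1 : cls 1 = 1%g.
Proof. by apply: val_inj; rewrite val_cls ?coprimen1. Qed.

Lemma cls_eq n d : coprime m n -> n = d %[mod m] -> cls n = cls d.
Proof.
move=> mn nd; have md : coprime m d by rewrite -coprime_modr -nd coprime_modr.
by apply: val_inj; rewrite !val_cls // -Zp_nat_mod // nd Zp_nat_mod.
Qed.

Lemma cls_inj n d : coprime m n -> coprime m d -> cls n = cls d -> n = d %[mod m].
Proof.
move=> mn md /(congr1 val); rewrite !val_cls // => /(congr1 val).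
by rewrite /= !val_Zp_nat.
Qed.

Lemma mulg_unitC g x : (g * x = x * g)%g.
Proof. by apply: val_inj; rewrite /= mulrC. Qed.

(* [f] read as an arithmetic function, with value [0] at integers not prime to [m]. *)
Definition uext f n : R := if coprime m n then f (cls n) else 0.

Lemma uext_mul f n d : uext f (n * d) = if coprime m n then uext (fun x => f (cls n * x)%g) d else 0.
Proof.
rewrite /uext coprimeMr; case mn: (coprime m n) => //=.
by case: ifP => // md; rewrite clsM.
Qed.

Lemma uext_addm f n : uext f (n + m) = uext f n.
Proof.
rewrite /uext -coprime_modr modnDr coprime_modr; case: ifP => // mn.
by congr f; apply/esym/cls_eq; rewrite ?modnDr.
Qed.

Lemma sum_uext_period f : \sum_(0 <= n < m) uext f n = \sum_g f g.
Proof.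
have {1}-> : m = (Zp_trunc m).+2 by rewrite Zp_cast.
rewrite big_mkord.
transitivity (\sum_(x : 'Z_m | x \is a GRing.unit) f (insubd (1%g : G) x)).
  rewrite [RHS]big_mkcond; apply: eq_bigr => x _; rewrite /uext /cls -unitZpE // natr_Zp.
  by [].
pose h (g : G) := val g; rewrite (reindex_onto h (insubd (1%g : G))) /h /=; last first.
  by move=> x ux; rewrite val_insubd ux.
by apply: eq_big => [g|g _]; rewrite valKd ?eqxx ?andbT ?(valP g).
Qed.

(** A full period sums to [0], so the partial sums from [0] are periodic and bounded by the absolute
    sum [B] over one period; an interval is a difference of two of them. *)
Lemma uext_interval_bounded f : \sum_g f g = 0 ->
  exists K, forall i k, (i <= k)%N -> `|\sum_(i <= n < k) uext f n| <= K.
Proof.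
move=> f0; pose P k := \sum_(0 <= n < k) uext f n.
pose B := \sum_(0 <= n < m) `|uext f n|.
have Pm k : P (m + k)%N = P k.
  rewrite /P (@big_cat_nat _ _ _ m) ?leq_addr //= sum_uext_period f0 add0r.
  rewrite -{1}[m]add0n big_addn addKn; apply: eq_bigr => n _; exact: uext_addm.
have PB k : `|P k| <= B.
  rewrite (divn_eq k m); elim: (k %/ m)%N => [|q IH]; last by rewrite mulSn -addnA Pm.
  rewrite mul0n add0n; apply: le_trans (ler_norm_sum _ _ _) _.
  have km : (k %% m <= m)%N by rewrite ltnW // ltn_mod ltnW.
  by rewrite /B (@big_cat_nat _ _ _ (k %% m) 0 m) //= lerDl sumr_ge0.
exists (B + B) => i k ik.
have -> : \sum_(i <= n < k) uext f n = P k - P i.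
  by rewrite /P (@big_cat_nat _ _ _ i 0 k) //= addrAC subrr add0r.
by apply: le_trans (ler_normB _ _) _; apply: lerD.
Qed.

Lemma uext_harmonic_limit f : \sum_g f g = 0 ->
  exists l C, forall N, `|\sum_(1 <= n < N.+1) uext f n / n%:R - l| <= C / N.+1%:R.
Proof.
move=> f0; have [K HK] := uext_interval_bounded f0.
have K0 : 0 <= K by apply: le_trans (HK 0 0 (leqnn 0)); rewrite ?normr_ge0.
have [||l hl] := @limit_of_cauchy R (fun N => \sum_(1 <= n < N.+1) uext f n / n%:R)
   (fun N => K / N.+1%:R).
- move=> x y xy; rewrite (@big_cat_nat _ _ _ x.+1 1 y.+1) //= addrAC subrr add0r.
  apply: (@norm_sum_monotone R (uext f) (fun n => n%:R^-1)) => [k xk|n xn|n xn].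
  + exact: HK.
  + by rewrite lef_pV2 ?posrE ?ltr0n ?ler_nat // (leq_trans _ xn).
  + by rewrite invr_ge0.
- by move=> x y xy; rewrite ler_wpM2l // lef_pV2 ?posrE ?ltr0n ?ler_nat.
by exists l, K.
Qed.

Lemma sum_translate f g : \sum_x f (g * x)%g = \sum_x f x.
Proof. by rewrite [RHS](reindex_inj (mulgI g)). Qed.

(** The indicator of [g] projected orthogonally to the constants. *)
Definition centered g x : R := (x == g)%:R - #|{: G}|%:R^-1.

Lemma sum_centered g : \sum_x centered g x = 0.
Proof.
rewrite /centered sumrB (bigD1 g) //= eqxx big1 ?addr0; last by move=> x /negbTE ->.
rewrite sumr_const -[X in _ - X]mulr_natl divff ?subrr // pnatr_eq0 -lt0n.
by apply/card_gt0P; exists g.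
Qed.

Lemma centered_expansion f x : \sum_g f g = 0 -> f x = \sum_g f g * centered g x.
Proof.
move=> f0; under eq_bigr do rewrite mulrBr.
rewrite sumrB -mulr_suml f0 mul0r subr0 (bigD1 x) //= eqxx mulr1 big1 ?addr0 //.
by move=> g; rewrite eq_sym => /negbTE ->; rewrite mulr0.
Qed.

Lemma centered_sym g x : centered g x = centered x g.
Proof. by rewrite /centered eq_sym. Qed.

(* [a g] is the series of [1 / n] over the class [g], regularised by subtracting the average over
   all classes; it makes [L] a convolution operator on all functions, vanishing on constants. *)
Lemma exists_kernel : exists (a : G -> R) (C : R), 0 <= C /\
  forall g N, `|\sum_(1 <= n < N.+1) uext (centered g) n / n%:R - a g| <= C / N.+1%:R.
Proof.
have /choice [aC HaC] : forall g, exists aC : R * R, forall N,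
   `|\sum_(1 <= n < N.+1) uext (centered g) n / n%:R - aC.1| <= aC.2 / N.+1%:R.
  by move=> g; have [l [C H]] := uext_harmonic_limit (sum_centered g); exists (l, C).
have C0 g : 0 <= (aC g).2.
  have := HaC g 0%N; rewrite divr1; apply: le_trans; exact: normr_ge0.
exists (fun g => (aC g).1), (\sum_g (aC g).2); split; first exact: sumr_ge0.
move=> g N; apply: le_trans (HaC g N) _; rewrite ler_wpM2r ?invr_ge0 //.
by rewrite (bigD1 g) //= lerDl sumr_ge0.
Qed.

Section Kernel.
Variables (a : G -> R) (C0 : R).
Hypothesis C0_ge0 : 0 <= C0.
Hypothesis aP : forall g N,
  `|\sum_(1 <= n < N.+1) uext (centered g) n / n%:R - a g| <= C0 / N.+1%:R.

Definition kernel_op f g : R := \sum_x f (g * x)%g * a x.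
Local Notation Lop := kernel_op.

Lemma kernel_op_tail f : \sum_g f g = 0 -> exists2 C, 0 <= C & forall g N,
  `|\sum_(1 <= n < N.+1) uext (fun x => f (g * x)%g) n / n%:R - Lop f g| <= C / N.+1%:R.
Proof.
move=> f0; exists ((\sum_x `|f x|) * C0); first by rewrite mulr_ge0 ?sumr_ge0.
move=> g N; pose fg x := f (g * x)%g.
have fg0 : \sum_x fg x = 0 by rewrite sum_translate.
have e n : uext fg n = \sum_k fg k * uext (centered k) n.
  rewrite /uext; case: ifP => _; first exact: centered_expansion.
  by rewrite big1 // => k _; rewrite mulr0.
have -> : \sum_(1 <= n < N.+1) uext fg n / n%:R - Lop f g
  = \sum_k fg k * (\sum_(1 <= n < N.+1) uext (centered k) n / n%:R - a k).
  under [RHS]eq_bigr do rewrite mulrBr mulr_sumr.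
  rewrite sumrB; congr (_ - _); rewrite exchange_big /=; apply: eq_bigr => n _.
  by rewrite e mulr_suml; apply: eq_bigr => k _; rewrite mulrA.
apply: le_trans (ler_norm_sum _ _ _) _.
rewrite -(sum_translate (fun x => `|f x|) g) -mulrA mulr_suml; apply: ler_sum => k _.
by rewrite normrM ler_wpM2l.
Qed.

Lemma sum_kernel : \sum_x a x = 0.
Proof.
apply/eqP; apply: contraT => nz.
(* The truncated series add up to [0] over all classes, so the total of [a] is at most the total
   truncation error, which tends to [0]. *)
have B N : `|\sum_x a x| * N.+1%:R <= #|{: G}|%:R * C0.
  rewrite -ler_pdivlMr ?ltr0n //.
  have -> : `|\sum_x a x| = `|\sum_x (\sum_(1 <= n < N.+1) uext (centered x) n / n%:R - a x)|.
    rewrite sumrB exchange_big /= [X in X - _]big1 ?sub0r ?normrN // => n _.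
    rewrite /uext; case: (coprime m n); last by rewrite big1 // => i _; rewrite mul0r.
    suff e : \sum_i centered i (cls n) = 0 by rewrite -mulr_suml e mul0r.
    under eq_bigr do rewrite centered_sym.
    exact: sum_centered.
  apply: le_trans (ler_norm_sum _ _ _) _.
  apply: (@le_trans _ _ (\sum_(x : G) C0 / N.+1%:R)); first by apply: ler_sum => x _; apply: aP.
  by rewrite sumr_const -[leLHS]mulr_natl mulrA.
have nz' : 0 < `|\sum_x a x| by rewrite normr_gt0.
have [n [n0 hn]] := natr_unbounded (#|{: G}|%:R * C0 / `|\sum_x a x|).
have := B n; rewrite mulrC -ler_pdivlMr // => /le_lt_trans/(_ hn).
by rewrite ltr_nat ltnNge leqnSn.
Qed.

Lemma sum_kernel_op f : \sum_g Lop f g = 0.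
Proof.
rewrite exchange_big /=.
under eq_bigr => x _ do under eq_bigr do rewrite mulg_unitC.
under eq_bigr do rewrite -mulr_suml sum_translate.
by rewrite -mulr_sumr sum_kernel mulr0.
Qed.

(** Writing [n = d * k], the inner sum over [k <= N / d] is the truncated series of [L f] at the
    class of [d], with error [O(d / N)]; the factor [1 / d] turns it into [O(1 / N)] for every
    [d]. *)
Lemma convolution_estimate f : \sum_g f g = 0 -> exists2 C, 0 <= C &
  forall (w : nat -> R) N, (0 < N)%N ->
  `|\sum_(1 <= n < N.+1) (\sum_(1 <= d < n.+1 | (d %| n)%N) w d) * (uext f n / n%:R)
    - \sum_(1 <= d < N.+1) w d * (uext (Lop f) d / d%:R)|
  <= C / N%:R * \sum_(1 <= d < N.+1) `|w d|.
Proof.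
move=> f0; have [C C_ge0 HC] := kernel_op_tail f0; exists C => // w N N0.
have N0' : 0 < N%:R :> R by rewrite ltr0n.
have -> : \sum_(1 <= n < N.+1) (\sum_(1 <= d < n.+1 | (d %| n)%N) w d) * (uext f n / n%:R)
  = \sum_(1 <= d < N.+1) \sum_(1 <= k < (N %/ d).+1) w d * (uext f (d * k) / (d * k)%:R).
  rewrite -(sum_divisor_pairs (fun d k => w d * (uext f (d * k) / (d * k)%:R))).
  apply: eq_bigr => n _; rewrite mulr_suml; apply: eq_bigr => d dn.
  by rewrite mulnC divnK.
rewrite -sumrB; apply: le_trans (ler_norm_sum _ _ _) _.
rewrite mulr_sumr big_nat [leRHS]big_nat; apply: ler_sum => d /andP[d0 dN].
have d0' : 0 < d%:R :> R by rewrite ltr0n.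
rewrite -mulr_sumr -mulrBr normrM mulrC ler_wpM2r //.
have -> : \sum_(1 <= k < (N %/ d).+1) uext f (d * k) / (d * k)%:R =
  (\sum_(1 <= k < (N %/ d).+1) uext f (d * k) / k%:R) / d%:R.
  by rewrite mulr_suml; apply: eq_bigr => k _; rewrite natrM invfM mulrA mulrAC.
rewrite -mulrBl normrM (ger0_norm (_ : 0 <= d%:R^-1)) ?invr_ge0 ?ler0n //.
rewrite ler_pdivrMr //.
under eq_bigr do rewrite uext_mul.
rewrite {2}/uext; case: ifP => md; last first.
  rewrite big1 ?subrr ?normr0 ?mulr_ge0 ?invr_ge0 ?ler0n // => k _; by rewrite mul0r.
apply: le_trans (HC _ _) _; rewrite -mulrA ler_wpM2l //.
rewrite mulrC ler_pdivlMr // mulrC ler_pdivrMr ?ltr0n // -natrM ler_nat.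
by rewrite mulnC ltnW // ltn_ceil.
Qed.

Definition mangoldt_sum N f : R := \sum_(1 <= n < N.+1) mangoldt n * (uext f n / n%:R).

Lemma sum_ln_uext_bounded f : \sum_g f g = 0 ->
  exists C, forall N, `|\sum_(1 <= n < N.+1) ln n%:R * (uext f n / n%:R)| <= C.
Proof.
move=> f0; have [K HK] := uext_interval_bounded f0.
exists (K * ((ln 1 + 1) / 1) + K * 1^-1) => N.
(* [ln n / n] is not monotone near [1], but [(ln n + 1) / n] and [1 / n] both decrease, so Abel
   summation applies to each. *)
have -> : \sum_(1 <= n < N.+1) ln n%:R * (uext f n / n%:R)
  = \sum_(1 <= n < N.+1) uext f n * ((ln n%:R + 1) / n%:R)
    - \sum_(1 <= n < N.+1) uext f n * n%:R^-1.
  rewrite -sumrB; apply: eq_bigr => n _.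
  by rewrite mulrDl mulrDr div1r addrK mulrCA.
apply: le_trans (ler_normB _ _) _; apply: lerD.
- apply: (@norm_sum_monotone R (uext f) (fun n => (ln n%:R + 1) / n%:R)) => [k|n n0|n n0].
  + exact: HK.
  + have := @ln_natS R n n0; rewrite -(natr1 n).
    have : 0 <= ln n%:R :> R by apply: ln_nat_ge0.
    have : 1 <= n%:R :> R by rewrite ler1n.
    set x : R := n%:R; set u : R := ln (x + 1); set v : R := ln x => x1 v0 h.
    have x0 : 0 < x by lra.
    rewrite -(ler_pM2l x0) divff ?gt_eqF // in h.
    rewrite ler_pdivrMr; last by lra.
    rewrite mulrAC ler_pdivlMr //; lra.
  + by rewrite divr_ge0 ?addr_ge0 ?ln_nat_ge0 ?ler0n.
- apply: (@norm_sum_monotone R (uext f) (fun n => n%:R^-1)) => [k|n n0|n n0].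
  + exact: HK.
  + by rewrite lef_pV2 ?posrE ?ltr0n ?ler_nat.
  + by rewrite invr_ge0.
Qed.

(** Take [w = mangoldt] in the convolution estimate: the divisor sums are [ln n], and the error is
    controlled by [psi N <= 4 * N]. *)
Lemma mangoldt_sum_kernel_op_bounded f : \sum_g f g = 0 ->
  exists C, forall N, (0 < N)%N -> `|mangoldt_sum N (Lop f)| <= C.
Proof.
move=> f0; have [C1 H1] := sum_ln_uext_bounded f0.
have [C2 C20 H2] := convolution_estimate f0.
exists (C1 + C2 * 4) => N N0; have N0' : 0 < N%:R :> R by rewrite ltr0n.
have := H2 mangoldt N N0.
have -> : \sum_(1 <= d < N.+1) `|mangoldt d| = psi R N.
  by apply: eq_bigr => d _; rewrite ger0_norm ?mangoldt_ge0.
have -> : \sum_(1 <= n < N.+1) (\sum_(1 <= d < n.+1 | (d %| n)%N) mangoldt d) * (uext f n / n%:R)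
  = \sum_(1 <= n < N.+1) ln n%:R * (uext f n / n%:R).
  by apply: eq_big_nat => n /andP[n0 _]; rewrite sum_mangoldt.
rewrite -/(mangoldt_sum N _) => h.
have h' : C2 / N%:R * psi R N <= C2 * 4.
  by rewrite -mulrA ler_wpM2l // mulrC ler_pdivrMr // psi_le.
have := H1 N; move: h; rewrite !ler_norml; lra.
Qed.

(** Take [w d = mobius d * (ln N - ln d)]: the terms with [L f] vanish, and the sum of [|w d|] is at
    most [N * ln N - ln N! <= N]. *)
Lemma mangoldt_sum_kernel f : \sum_g f g = 0 -> (forall g, Lop f g = 0) ->
  exists C, forall N, (0 < N)%N -> `|mangoldt_sum N f + f 1%g * ln N%:R| <= C.
Proof.
move=> f0 Lf0; have [C C_ge0 HC] := convolution_estimate f0.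
exists C => N N0; have N0' : 0 < N%:R :> R by rewrite ltr0n.
have := HC (fun d => mobius d * (ln N%:R - ln d%:R)) N N0.
rewrite [X in `|_ - X|]big1 ?subr0; last first.
  by move=> d _; rewrite /uext; case: ifP; rewrite ?Lf0 mul0r mulr0.
have -> : \sum_(1 <= n < N.+1) (\sum_(1 <= d < n.+1 | (d %| n)%N) mobius d * (ln N%:R - ln d%:R)) * (uext f n / n%:R)
   = mangoldt_sum N f + f 1%g * ln N%:R.
  transitivity (\sum_(1 <= n < N.+1) (mangoldt n * (uext f n / n%:R) +
     (if n == 1 then f 1%g * ln N%:R else 0))).
    apply: eq_big_nat => n /andP[n0 _]; rewrite mobius_selberg_weight // mulrDl; congr (_ + _).
    case: eqP => [->|_]; last by rewrite !mul0r.
    by rewrite mul1r divr1 /uext coprimen1 cls1 mulrC.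
  rewrite big_split /= -/(mangoldt_sum N f); congr (_ + _).
  rewrite big_ltn //= big1_seq ?addr0 //.
  by move=> n /andP[_]; rewrite mem_index_iota => /andP[n1 _]; rewrite gtn_eqF.
move=> h; apply: le_trans h _.
apply: (@le_trans _ _ (C / N%:R * (N%:R * ln N%:R - ln N`!%:R))).
  rewrite ler_wpM2l ?divr_ge0 ?ler0n // ln_factorial.
  have -> : N%:R * ln N%:R = \sum_(1 <= n < N.+1) ln N%:R :> R.
    by rewrite sumr_const_nat subn1 mulr_natl.
  rewrite -sumrB big_nat [leRHS]big_nat; apply: ler_sum => d /andP[d0 dN].
  have h0 : 0 <= ln N%:R - ln d%:R :> R.
    by rewrite subr_ge0 ler_ln ?posrE ?ltr0n // ler_nat.
  rewrite normrM (ger0_norm h0) ler_piMl ?normr_mobius //.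
rewrite -mulrA ler_piMr // mulrC ler_pdivrMr // mul1r.
have := @ln_factorial_ge R N; lra.
Qed.
End Kernel.
End ResidueClasses.

Lemma sum_mangoldt_few_primes (R : realType) (P : pred nat) B N :
  (forall n, prime n -> P n -> (n <= B)%N) ->
  \sum_(1 <= n < N.+1 | P n) mangoldt R n / n%:R
  <= 2 + \sum_(1 <= n < B.+1) mangoldt R n / n%:R.
Proof.
move=> HP; have t0 n : 0 <= mangoldt R n / n%:R by rewrite divr_ge0 ?mangoldt_ge0 ?ler0n.
rewrite (bigID (fun n => ~~ prime n)) /=; apply: lerD.
  apply: le_trans (sum_mangoldt_nonprime R N).
  rewrite big_mkcond [leRHS]big_mkcond; apply: ler_sum => n _.
  by case: (P n); case: (prime n) => /=.
(* The range is enlarged to [N + B] so that it contains every [n <= B] whatever the size of [N]. *)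
apply: (@le_trans _ _ (\sum_(1 <= n < (N + B).+1 | (n <= B)%N) mangoldt R n / n%:R)).
  rewrite (@big_cat_nat _ _ _ N.+1 1 (N + B).+1) ?ltnS ?leq_addr //=.
  rewrite -[leLHS]addr0; apply: lerD; last exact: sumr_ge0.
  rewrite big_mkcond [leRHS]big_mkcond; apply: ler_sum => n _.
  rewrite negbK; case: ifP => [/andP[Pn pn]|_]; last by case: ifP.
  by rewrite HP.
rewrite -(@big_nat_widen _ _ _ 1 B.+1 (N + B).+1 xpredT) //.
by rewrite ltnS leq_addl.
Qed.

(** * The kernel of [L]: orthogonality, reproducing kernel and characters *)

Section Spectral.
Variables (R : realType) (m : nat).
Hypothesis m1 : (1 < m)%N.
Local Notation G := {unit 'Z_m}.
Implicit Types (f h u v : G -> R) (g x : G) (N : nat).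
Variables (a : G -> R) (C0 : R).
Hypothesis C0_ge0 : 0 <= C0.
Hypothesis aP : forall g N,
  `|\sum_(1 <= n < N.+1) uext (centered R g) n / n%:R - a g| <= C0 / N.+1%:R.
Local Notation Lop := (kernel_op a).

Definition Ladj f x : R := \sum_h f h * a (h^-1 * x)%g.

Lemma kernel_opE f x : Lop f x = \sum_h f h * a (x^-1 * h)%g.
Proof.
rewrite /kernel_op [RHS](reindex_inj (mulgI x)) /=.
by apply: eq_bigr => k _; rewrite mulKg.
Qed.

Definition group_mx : 'M[R]_#|{: G}| :=
  \matrix_(i, j) a ((enum_val j)^-1 * enum_val i)%g.

Definition fun_row f : 'rV[R]_#|{: G}| := \row_i f (enum_val i).

Lemma fun_row_mx f i : (fun_row f *m group_mx) 0 i = Lop f (enum_val i).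
Proof.
rewrite mxE kernel_opE [RHS]big_enum_val; apply: eq_bigr => j _.
by rewrite !mxE.
Qed.

Lemma fun_row_mxT f i : (fun_row f *m group_mx^T) 0 i = Ladj f (enum_val i).
Proof.
rewrite mxE /Ladj [RHS]big_enum_val; apply: eq_bigr => j _.
by rewrite !mxE.
Qed.

(** Since the group is commutative, the substitution [x -> gi * x^-1 * gj] carries one product into
    the other. *)
Lemma group_mx_normal : group_mx *m group_mx^T = group_mx^T *m group_mx.
Proof.
apply/matrixP => i j; rewrite !mxE; set gi : G := enum_val i; set gj : G := enum_val j.
transitivity (\sum_x a (x^-1 * gi)%g * a (x^-1 * gj)%g).
  by rewrite [RHS]big_enum_val; apply: eq_bigr => k _; rewrite !mxE.
transitivity (\sum_x a (gi^-1 * x)%g * a (gj^-1 * x)%g); last first.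
  by rewrite [LHS]big_enum_val; apply: eq_bigr => k _; rewrite !mxE.
have inj : injective (fun x : G => gi * x^-1 * gj)%g.
  by move=> x y /mulIg/mulgI/invg_inj.
rewrite (reindex_inj inj) /=; apply: eq_bigr => x _.
rewrite !invMg invgK mulrC; congr (a _ * a _).
  by rewrite mulgA (mulg_unitC _ gj) mulgA mulgA mulgV mul1g mulg_unitC.
by rewrite mulgA mulgKV.
Qed.

Lemma row_fun (w : 'rV[R]_#|{: G}|) : exists f, fun_row f = w.
Proof.
exists (fun x => w 0 (enum_rank x)); apply/rowP => i; by rewrite !mxE enum_valK.
Qed.

Lemma kernel_op_adjoint v : (forall x, Lop v x = 0) -> forall x, Ladj v x = 0.
Proof.
move=> Lv x; have h : fun_row v *m group_mx = 0.
  by apply/rowP => i; rewrite fun_row_mx Lv mxE.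
have := normal_kernel_trmx group_mx_normal h.
by move/rowP/(_ (enum_rank x)); rewrite fun_row_mxT enum_rankK mxE.
Qed.

Lemma kernel_op_decomposition u : exists k h, (forall x, u x = k x + Lop h x) /\
  forall x, Lop k x = 0.
Proof.
have [rk [rh]] := normal_decomposition group_mx_normal (fun_row u).
have [k <-] := row_fun rk; have [h <-] := row_fun rh => -[e1 e2].
exists k, h; split => x.
  transitivity (fun_row u 0 (enum_rank x)); first by rewrite mxE enum_rankK.
  by rewrite e1 mxE fun_row_mx mxE enum_rankK.
by move/rowP/(_ (enum_rank x)): e2; rewrite fun_row_mx enum_rankK mxE.
Qed.

Definition null_fun v := \sum_x v x = 0 /\ forall x, Lop v x = 0.

Lemma null_translate v g : null_fun v -> null_fun (fun x => v (g * x)%g).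
Proof.
move=> [v0 Lv]; split; first by rewrite sum_translate.
by move=> x; rewrite -[RHS](Lv (g * x)%g); apply: eq_bigr => k _; rewrite mulgA.
Qed.

(** By normality a function killed by [L] is also killed by its adjoint. *)
Lemma null_orthogonal v h : null_fun v -> \sum_x v x * Lop h x = 0.
Proof.
move=> [v0 Lv]; under eq_bigr do rewrite kernel_opE mulr_sumr.
rewrite exchange_big big1 //= => y _.
rewrite -[RHS](mulr0 (h y)) -[in RHS](kernel_op_adjoint Lv y) mulr_sumr.
by apply: eq_bigr => x _; rewrite mulrCA.
Qed.

(** [L] kills constants, so [h] can be shifted to have sum zero; values of [L] sum to zero, hence so
    does the kernel part. *)
Lemma sum_zero_decomposition u : \sum_x u x = 0 -> exists e h,
  [/\ null_fun e, \sum_x h x = 0 & forall x, u x = e x + Lop h x].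
Proof.
move=> u0; have [k [h [ue Lk]]] := kernel_op_decomposition u.
pose c := (\sum_x h x) / #|{: G}|%:R.
have n0 : #|{: G}|%:R != 0 :> R.
  by rewrite pnatr_eq0 -lt0n; apply/card_gt0P; exists 1%g.
exists k, (fun x => h x - c); split.
- split=> //; move: u0; under eq_bigr do rewrite ue.
  by rewrite big_split /= (sum_kernel_op aP) addr0.
- by rewrite sumrB sumr_const -[X in _ - X]mulr_natr /c divfK ?subrr.
- move=> x; rewrite ue; congr (_ + _); rewrite /kernel_op.
  under [RHS]eq_bigr do rewrite mulrBl.
  by rewrite sumrB -mulr_sumr (sum_kernel aP) mulr0 subr0.
Qed.

Lemma uext_add f h n : uext (fun x => f x + h x) n = uext f n + uext h n.
Proof. by rewrite /uext; case: ifP; rewrite ?addr0. Qed.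

Lemma mangoldt_sum_add N f h : mangoldt_sum N (fun x => f x + h x) = mangoldt_sum N f + mangoldt_sum N h.
Proof.
rewrite /mangoldt_sum -big_split; apply: eq_bigr => n _ /=.
by rewrite uext_add mulrDl mulrDr.
Qed.

Lemma mangoldt_sum_scale N (c : R) f : mangoldt_sum N (fun x => c * f x) = c * mangoldt_sum N f.
Proof.
rewrite /mangoldt_sum mulr_sumr; apply: eq_bigr => n _ /=.
by rewrite /uext; case: ifP => _; rewrite ?mul0r ?mulr0 // -mulrA mulrCA.
Qed.

Lemma eq_mangoldt_sum N f h : f =1 h -> mangoldt_sum N f = mangoldt_sum N h.
Proof. by move=> e; apply: eq_bigr => n _; rewrite /uext; case: ifP; rewrite ?e. Qed.

Lemma mangoldt_sum_ge0 N f : (forall x, 0 <= f x) -> 0 <= mangoldt_sum N f.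
Proof.
move=> f0; apply: sumr_ge0 => n _; rewrite mulr_ge0 ?mangoldt_ge0 // divr_ge0 ?ler0n //.
by rewrite /uext; case: ifP.
Qed.

Lemma mangoldt_sum1_le N : (0 < N)%N -> mangoldt_sum N (fun _ : G => 1 : R) <= ln N%:R + 4.
Proof.
move=> N0; apply: le_trans (mertens_le R N0); apply: ler_sum => n _.
rewrite ler_wpM2l ?mangoldt_ge0 // ler_piMl ?invr_ge0 ?ler0n //.
by rewrite /uext; case: ifP.
Qed.

Lemma mangoldt_sum1_ge : exists C, forall N, (0 < N)%N -> ln N%:R - C <= mangoldt_sum N (fun _ : G => 1 : R).
Proof.
exists (1 + (2 + \sum_(1 <= n < m.+1) mangoldt R n / n%:R)) => N N0.
have h1 := mertens_ge R N0.
have h2 : \sum_(1 <= n < N.+1 | ~~ coprime m n) mangoldt R n / n%:R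
  <= 2 + \sum_(1 <= n < m.+1) mangoldt R n / n%:R.
  apply: sum_mangoldt_few_primes => n pn.
  by rewrite coprime_sym prime_coprime // negbK => /dvdn_leq; apply; apply: ltnW.
move: h1; rewrite (bigID (fun n => coprime m n)) /=.
have -> : \sum_(1 <= n < N.+1 | coprime m n) mangoldt R n / n%:R = mangoldt_sum N (fun _ : G => 1 : R).
  rewrite big_mkcond; apply: eq_bigr => n _.
  by rewrite /uext; case: ifP; rewrite ?mul1r // mul0r mulr0.
lra.
Qed.

Local Notation card := (#|{: G}|%:R : R).

Lemma card_gt0R : 0 < card.
Proof. by rewrite ltr0n; apply/card_gt0P; exists 1%g. Qed.

Lemma mangoldt_sum_delta N g :
  mangoldt_sum N (fun x => (x == g)%:R) = mangoldt_sum N (centered R g) + card^-1 * mangoldt_sum N (fun _ : G => 1 : R).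
Proof.
rewrite -mangoldt_sum_scale -mangoldt_sum_add; apply: eq_mangoldt_sum => x.
by rewrite /centered mulr1 subrK.
Qed.

Lemma null_reproducing : exists e, [/\ null_fun e, e 1%g <= card^-1 &
  forall v, null_fun v -> v 1%g = \sum_x v x * e x].
Proof.
have [e [h [Ve h0 ceh]]] := sum_zero_decomposition (sum_centered R (1%g : G)).
exists e; split=> // [|v Vv].
  (* Otherwise the nonnegative sum over the class of [1] would be at most
     [(card^-1 - e 1) * ln N + O(1)], which becomes negative. *)
  rewrite leNgt; apply/negP => lt.
  have [C1 H1] := mangoldt_sum_kernel_op_bounded m1 C0_ge0 aP h0.
  have [C2 H2] := mangoldt_sum_kernel m1 C0_ge0 aP Ve.1 Ve.2.
  have [N [N0 hN]] := ln_unbounded ((C1 + C2 + card^-1 * 4) / (e 1%g - card^-1)).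
  have := mangoldt_sum_ge0 N (f := fun x => (x == 1%g)%:R) (fun=> ler0n _ _).
  rewrite mangoldt_sum_delta (eq_mangoldt_sum N ceh) mangoldt_sum_add.
  have := H1 N N0; rewrite ler_norml => /andP[_ h1].
  have := H2 N N0; rewrite ler_norml => /andP[_ h2].
  have h3 : card^-1 * mangoldt_sum N (fun _ : G => 1 : R) <= card^-1 * (ln N%:R + 4).
    by rewrite ler_wpM2l ?mangoldt_sum1_le // invr_ge0 ltW // card_gt0R.
  move: hN; rewrite ltr_pdivrMr ?subr_gt0 //.
  move: h1 h2 h3; lra.
transitivity (\sum_x v x * centered R 1%g x).
  by rewrite {1}(centered_expansion 1%g Vv.1); apply: eq_bigr => x _; rewrite centered_sym.
under eq_bigr do rewrite ceh mulrDr.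
by rewrite big_split /= null_orthogonal // addr0.
Qed.

(* Bessel: expand [0 <= sum_x (v (g * x) - card * v g * e x) ^ 2] with the reproducing kernel [e];
   summing the resulting bounds over [g] forces equality everywhere. *)
Lemma null_sqr v : null_fun v -> forall g, card * v g ^+ 2 = \sum_x v x ^+ 2.
Proof.
move=> Vv; have [e [Ve e1 He]] := null_reproducing.
pose S := \sum_x v x ^+ 2.
have le g : card * v g ^+ 2 <= S.
  have vg : v g = \sum_x v (g * x)%g * e x.
    by rewrite -(He _ (null_translate g Vv)) mulg1.
  have e2 : \sum_x e x ^+ 2 = e 1%g by rewrite (He _ Ve).
  have : 0 <= \sum_x (v (g * x)%g - (card * v g) * e x) ^+ 2.
    by apply: sumr_ge0 => x _; apply: sqr_ge0.
  have -> : \sum_x (v (g * x)%g - (card * v g) * e x) ^+ 2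
    = S - 2 * card * v g * v g + (card * v g) ^+ 2 * e 1%g.
    rewrite {3}vg -e2 /S -(sum_translate (fun x => v x ^+ 2) g) !mulr_sumr -sumrB -big_split /=.
    by apply: eq_bigr => x _; ring.
  have : (card * v g) ^+ 2 * e 1%g <= card * v g ^+ 2.
    apply: (@le_trans _ _ ((card * v g) ^+ 2 * card^-1)); first by rewrite ler_wpM2l ?sqr_ge0.
    by rewrite le_eqVlt; apply/orP; left; apply/eqP; field; rewrite gt_eqF ?card_gt0R.
  rewrite [_ * v g * v g](_ : _ = 2 * (card * v g ^+ 2)); last by ring.
  lra.
have z : \sum_g (S - card * v g ^+ 2) = 0.
  by rewrite sumrB -mulr_sumr sumr_const -[X in X - _]mulr_natl subrr.
have pos x : true -> 0 <= S - card * v x ^+ 2 by rewrite subr_ge0.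
by move=> g; have /eqP := psumr_eq0P pos z (i := g) isT; rewrite subr_eq0 => /eqP.
Qed.

(** Normalise a translate of [v] to have value [1] at [1]; constant absolute value gives
    [chi x ^+ 2 = 1]. The null function [y -> chi (x * y) - chi x * chi y] vanishes at [1], hence
    everywhere. *)
Lemma null_character v x0 : null_fun v -> v x0 != 0 -> exists chi, [/\ null_fun chi,
  chi 1%g = 1, forall x y, chi (x * y)%g = chi x * chi y & forall x, chi x ^+ 2 = 1].
Proof.
move=> Vv nz; pose chi x := v (x0 * x)%g / v x0.
have comb (c : R) f h : null_fun f -> null_fun h -> null_fun (fun x => f x - c * h x).
  move=> [f0 Lf] [h0 Lh]; split; first by rewrite sumrB -mulr_sumr f0 h0 mulr0 subr0.
  move=> x; rewrite -[RHS](subr0 0) -{1}(Lf x) -(mulr0 c) -(Lh x) mulr_sumr -sumrB.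
  by apply: eq_bigr => y _; rewrite mulrBl mulrA.
have Vchi : null_fun chi.
  have [f0 Lf] := null_translate x0 Vv; split; first by rewrite -mulr_suml f0 mul0r.
  move=> x; rewrite -[RHS](mul0r (v x0)^-1) -(Lf x) mulr_suml.
  by apply: eq_bigr => y _; rewrite mulrAC.
have chi1 : chi 1%g = 1 by rewrite /chi mulg1 divff.
have sq x : chi x ^+ 2 = 1.
  have h1 := null_sqr Vchi x; rewrite -(null_sqr Vchi 1%g) chi1 in h1.
  by move/(mulfI _): h1; rewrite expr1n => -> //; rewrite gt_eqF ?card_gt0R.
exists chi; split=> // x y.
have V' := comb (chi x) _ _ (null_translate x Vchi) Vchi.
have := null_sqr V' y; rewrite -(null_sqr V' 1%g) mulg1 chi1 mulr1 subrr expr0n /= mulr0.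
move/eqP; rewrite mulf_eq0 gt_eqF ?card_gt0R //= sqrf_eq0 subr_eq0 => /eqP.
by [].
Qed.

(** Without kernel, [centered g] is a value of [L] and has bounded sums, so the class of [g]
    receives [ln N / #|G|] up to a bounded error from below. *)
Lemma mangoldt_sum_delta_unbounded g : (forall v, null_fun v -> forall x, v x = 0) ->
  forall B, exists N, (0 < N)%N /\ B < mangoldt_sum N (fun x => (x == g)%:R : R).
Proof.
move=> V0 B; have [e [h [Ve h0 ceh]]] := sum_zero_decomposition (sum_centered R g).
have [C1 H1] := mangoldt_sum_kernel_op_bounded m1 C0_ge0 aP h0.
have [C2 H2] := mangoldt_sum1_ge.
have [N [N0 hN]] := ln_unbounded (C2 + card * (B + C1)).
exists N; split=> //; rewrite mangoldt_sum_delta.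
have -> : mangoldt_sum N (centered R g) = mangoldt_sum N (Lop h).
  by apply: eq_mangoldt_sum => x; rewrite ceh V0 // add0r.
have := H1 N N0; rewrite ler_norml => /andP[h1 _].
have := H2 N N0 => h2.
have : card^-1 * (card * (B + C1)) < card^-1 * mangoldt_sum N (fun _ : G => 1 : R).
  rewrite ltr_pM2l ?invr_gt0 ?card_gt0R //; lra.
rewrite mulrA mulVf ?mul1r ?gt_eqF ?card_gt0R //; lra.
Qed.
End Spectral.

(** * Quadratic characters *)

Lemma bernoulli (F : realFieldType) (x : F) n : 0 <= x <= 1 -> 1 - n%:R * x <= (1 - x) ^+ n.
Proof.
move=> /andP[x0 x1]; elim: n => [|n IH]; first by rewrite mul0r subr0 expr0.
rewrite exprS; apply: (@le_trans _ _ ((1 - x) * (1 - n%:R * x))); last first.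
  by rewrite ler_wpM2l // subr_ge0.
have : 0 <= n%:R * x * x by rewrite !mulr_ge0 ?ler0n.
rewrite -natr1; lra.
Qed.

Lemma geometric_sum (F : fieldType) (y : F) M : y != 1 ->
  \sum_(1 <= k < M.+1) y ^+ k = (y - y ^+ M.+1) / (1 - y).
Proof.
move=> y1; have y1' : 1 - y != 0 by rewrite subr_eq0 eq_sym.
elim: M => [|M IH]; first by rewrite big_geq // expr1 subrr mul0r.
by rewrite big_nat_recr //= IH; rewrite !exprS; field.
Qed.

Lemma sum_squares_le (F : numDomainType) (c : nat -> F) J N :
  (forall n, (0 < n)%N -> 0 <= c n) -> (J ^ 2 <= N)%N ->
  \sum_(1 <= k < J.+1) c (k ^ 2)%N <= \sum_(1 <= n < N.+1) c n.
Proof.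
move=> c0; elim: J N => [|J IH] N JN.
  rewrite big_geq // big_nat_cond; apply: sumr_ge0 => n; by rewrite andbT => /andP[n0 _]; apply: c0.
have lt : (J ^ 2 < N)%N by apply: leq_trans JN; rewrite ltn_exp2r.
rewrite big_nat_recr //= (@big_cat_nat _ _ _ (J ^ 2).+1 1 N.+1) ?ltnS ?(ltnW lt) //=.
apply: lerD; first exact: IH.
rewrite (bigD1_seq (J.+1 ^ 2)%N) ?iota_uniq //=; last first.
  by rewrite mem_index_iota ltnS JN ltn_exp2r //= ltnSn.
rewrite lerDl big_nat_cond; apply: sumr_ge0 => n /andP[/andP[n0 _] _].
by apply: c0; apply: leq_ltn_trans n0.
Qed.

Section RealCharacter.
Variables (R : realType) (chi : nat -> R) (K C : R).
Hypothesis chi1 : chi 1 = 1.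
Hypothesis chiM : forall a b, chi (a * b)%N = chi a * chi b.
Hypothesis chi_sgn : forall n, [\/ chi n = 0, chi n = 1 | chi n = -1].
Hypothesis chiK : forall i k, (i <= k)%N -> `|\sum_(i <= n < k) chi n| <= K.
Hypothesis chiC : forall N, `|\sum_(1 <= n < N.+1) chi n / n%:R| <= C / N.+1%:R.

(** The coefficients of the Dirichlet series [zeta(s) * L(s, chi)], and of the Lambert series of
    [chi]. *)
Definition divsum n : R := \sum_(1 <= d < n.+1 | (d %| n)%N) chi d.

Lemma divsum1 : divsum 1 = 1.
Proof. by rewrite /divsum big_mkcond big_nat1. Qed.

Lemma divsumS p k u : prime p -> (0 < u)%N -> ~~ (p %| u)%N ->
  divsum (p ^ k.+1 * u) = divsum u + chi p * divsum (p ^ k * u).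
Proof.
move=> pp u0 pu; have p0 := prime_gt0 pp.
have n0 : (0 < p ^ k.+1 * u)%N by rewrite muln_gt0 expn_gt0 p0.
rewrite {1}/divsum (bigID (fun d => (p %| d)%N)) /= addrC; congr (_ + _).
  under eq_bigl do rewrite dvdn_part_coprime //.
  have -> : ((p ^ k.+1 * u)`_p^' = u)%N.
    rewrite partnM ?expn_gt0 ?p0 // part_p'nat ?mul1n ?part_pnat_id ?p'natE //.
    by rewrite pnatNK pnatX pnat_id.
  by rewrite sum_divisors_dvd // dvdn_mull.
rewrite sum_divisors_multiple // ?expnS -?mulnA ?dvdn_mulr // mulKn //.
by rewrite /divsum mulr_sumr; apply: eq_bigr => d _; rewrite chiM.
Qed.

(** [s] is the local factor [1 + chi p + ... + chi p ^+ k]: it is [1], [k.+1] or the indicator of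
    even [k] as [chi p] is [0], [1] or [-1]. *)
Lemma divsum_pfactor p k u : prime p -> (0 < u)%N -> ~~ (p %| u)%N ->
  exists s, [/\ divsum (p ^ k * u) = s * divsum u, 0 <= s & ~~ odd k -> 1 <= s].
Proof.
move=> pp u0 pu; case: (chi_sgn p) => cp.
- exists 1; split; rewrite ?ler01 // mul1r; case: k => [|k]; first by rewrite mul1n.
  by rewrite divsumS // cp mul0r addr0.
- exists k.+1%:R; split; rewrite ?ler0n ?ler1n //.
  elim: k => [|k IH]; first by rewrite mul1n mul1r.
  by rewrite divsumS // IH cp mul1r -[in RHS]natr1; ring.
- exists (~~ odd k)%:R; split; rewrite ?ler0n //; last by move=> ->.
  elim: k => [|k IH]; first by rewrite mul1n mul1r.
  by rewrite divsumS // IH cp /=; case: (odd k) => /=; ring.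
Qed.

Lemma divsum_bounds n : (0 < n)%N ->
  0 <= divsum n /\ ((forall p, prime p -> ~~ odd (logn p n)) -> 1 <= divsum n).
Proof.
elim/ltn_ind: n => n IH n0; have [->|n1] := eqVneq n 1%N.
  by rewrite divsum1 ler01.
have n2 : (1 < n)%N by rewrite ltn_neqAle eq_sym n1.
move: (pdiv_prime n2) (pdiv_dvd n); move: (pdiv n) => p pp pn.
have en : n = (p ^ logn p n * n`_p^')%N by rewrite -p_part partnC.
have u0 : (0 < n`_p^')%N by apply: part_gt0.
have pu : ~~ (p %| n`_p^')%N by have := part_pnat p^' n; rewrite p'natE.
have k0 : (0 < logn p n)%N by rewrite logn_gt0 mem_primes pp n0 pn.
have un : (n`_p^' < n)%N.
  by rewrite {2}en ltn_Pmull // -(exp1n (logn p n)) ltn_exp2r // prime_gt1.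
have [h1 h2] := IH _ un u0.
have [s [es s0 s1]] := divsum_pfactor (logn p n) pp u0 pu.
rewrite -en in es; rewrite es; split; first exact: mulr_ge0.
move=> ev; rewrite -[1]mulr1; apply: ler_pM => //; first exact/s1/ev.
apply: h2 => l lp; have [->|lp'] := eqVneq l p.
  by rewrite (_ : logn p _ = 0%N) //; apply/eqP; rewrite -leqn0 leqNgt logn_gt0 mem_primes (negbTE pu) !andbF.
suff <- : logn l n = logn l n`_p^' by apply: ev.
rewrite [in LHS]en lognM ?expn_gt0 ?(prime_gt0 pp) //.
by rewrite lognX (logn_prime l pp) (negbTE lp') muln0.
Qed.

Lemma divsum_square k : (0 < k)%N -> 1 <= divsum (k ^ 2).
Proof.
move=> k0; apply: (divsum_bounds _).2; first by rewrite expn_gt0 k0.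
by move=> p _; rewrite lognX mul2n odd_double.
Qed.

Section Lambert.
Variable s : R.
Hypothesis s01 : 0 < s < 1.
(** A square, so that the geometric means of powers of [t] are powers of [s]. *)
Let t := s ^+ 2.
Let s0 : 0 < s. Proof. by case/andP: s01. Qed.
Let s1 : s < 1. Proof. by case/andP: s01. Qed.
Let t0 : 0 < t. Proof. exact: exprn_gt0. Qed.
Let t1 : t < 1. Proof. by rewrite exprn_ilt1 // ltW. Qed.
Let t1' : 0 < 1 - t. Proof. by rewrite subr_gt0. Qed.

Lemma one_minus_tX n : 1 - t ^+ n = (1 - t) * \sum_(i < n) t ^+ i.
Proof. by rewrite -opprB subrX1 -mulNr opprB. Qed.

(* AM-GM on the symmetric pairs of terms [s ^+ (2 * i)] and [s ^+ (2 * (n - i))]. *)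
Lemma geometric_mean_le n : n.+1%:R * s ^+ n <= \sum_(i < n.+1) t ^+ i.
Proof.
have e : \sum_(i < n.+1) t ^+ i = \sum_(i < n.+1) t ^+ (n - i).
  by rewrite (reindex_inj rev_ord_inj) /=; apply: eq_bigr => i _; rewrite subSS.
rewrite -(ler_pM2l (ltr0Sn R 1)).
have -> : 2 * \sum_(i < n.+1) t ^+ i = \sum_(i < n.+1) t ^+ i + \sum_(i < n.+1) t ^+ (n - i).
  by rewrite -e; ring.
rewrite -big_split /=.
have -> : 2 * (n.+1%:R * s ^+ n) = \sum_(i < n.+1) 2 * s ^+ n.
  by rewrite sumr_const card_ord -[RHS]mulr_natl; ring.
apply: ler_sum => i _; have le : (i <= n)%N by rewrite -ltnS.
have -> : s ^+ n = s ^+ i * s ^+ (n - i) by rewrite -exprD subnKC.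
rewrite -!exprM mulnC [(2 * (n - i))%N]mulnC !exprM -subr_ge0.
have -> : (s ^+ i) ^+ 2 + (s ^+ (n - i)) ^+ 2 - 2 * (s ^+ i * s ^+ (n - i))
   = (s ^+ i - s ^+ (n - i)) ^+ 2 by ring.
exact: sqr_ge0.
Qed.

(* If [L(1, chi) = 0], the Lambert series of [chi] equals [- sum chi(n) lambert(n)], bounded since
   [lambert] is decreasing; but its coefficients [divsum] are at least [1] at squares. *)
Definition lambert n : R := (n%:R * (1 - t))^-1 - t ^+ n / (1 - t ^+ n).

Lemma lambertE n : (0 < n)%N ->
  lambert n = (n%:R^-1 - t ^+ n / \sum_(i < n) t ^+ i) / (1 - t).
Proof.
case: n => // n _; rewrite /lambert one_minus_tX.
by rewrite !invfM; ring.
Qed.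

Lemma lambert_ge0 n : (0 < n)%N -> 0 <= lambert n.
Proof.
move=> n0; rewrite lambertE // divr_ge0 ?(ltW t1') // subr_ge0.
case: n n0 => // n _; have h := geometric_mean_le n.
have q0 : 0 < \sum_(i < n.+1) t ^+ i.
  by apply: lt_le_trans h; rewrite mulr_gt0 ?ltr0Sn ?exprn_gt0.
rewrite ler_pdivrMr // mulrC ler_pdivlMr ?ltr0Sn //.
apply: le_trans h; rewrite mulrC ler_wpM2l ?ler0n // /t -exprM.
by rewrite ler_wiXn2l ?(ltW s0) ?(ltW s1) //; lia.
Qed.

Lemma lambert_decr n : (0 < n)%N -> lambert n.+1 <= lambert n.
Proof.
move=> n0; rewrite !lambertE // ler_pM2r ?invr_gt0 //.
case: n n0 => // n _.
have h1 := geometric_mean_le n; have h2 := geometric_mean_le n.+1.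
have q1 : 0 < \sum_(i < n.+1) t ^+ i.
  by apply: lt_le_trans h1; rewrite mulr_gt0 ?ltr0Sn ?exprn_gt0.
have q2 : 0 < \sum_(i < n.+2) t ^+ i.
  by apply: lt_le_trans h2; rewrite mulr_gt0 ?ltr0Sn ?exprn_gt0.
have x0 : 0 < n.+1%:R :> R by [].
(* Since [Q' - t * Q = 1] for the two geometric sums, clearing denominators reduces the claim to
   this product of two AM-GM bounds. *)
have h : n.+1%:R * n.+2%:R * t ^+ n.+1 <= (\sum_(i < n.+1) t ^+ i) * \sum_(i < n.+2) t ^+ i.
  apply: le_trans (ler_pM _ _ h1 h2); rewrite ?mulr_ge0 ?ler0n ?exprn_ge0 ?(ltW s0) //.
  rewrite mulrACA -exprD ler_wpM2l ?mulr_ge0 ?ler0n // /t -exprM.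
  by rewrite ler_wiXn2l ?(ltW s0) ?(ltW s1) // mul2n -addnn leq_add2r.
have e1 : \sum_(i < n.+2) t ^+ i = \sum_(i < n.+1) t ^+ i + t ^+ n.+1 by rewrite big_ord_recr.
have e2 : 1 = (1 - t) * \sum_(i < n.+1) t ^+ i + t ^+ n.+1 by rewrite -one_minus_tX subrK.
rewrite (exprS t n.+1); rewrite -(natr1 n.+1) in h *.
move: h e1 e2 q1 q2; set Q := \sum_(i < n.+1) _; set Q' := \sum_(i < n.+2) _.
set y := t ^+ n.+1; move: x0; set x : R := n.+1%:R => x0 h e1 e2 q1 q2.
rewrite -subr_ge0.
have -> : x^-1 - y / Q - ((x + 1)^-1 - t * y / Q')
  = (Q * Q' - x * (x + 1) * y * (Q' - t * Q)) / (x * (x + 1) * (Q * Q')).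
  by field; rewrite !gt_eqF //; lra.
have -> : Q' - t * Q = 1 by rewrite e1 [RHS]e2; ring.
by rewrite mulr1 divr_ge0 ?subr_ge0 // !mulr_ge0 //; lra.
Qed.

Lemma lambert1 : lambert 1 = 1.
Proof. by rewrite /lambert mul1r expr1; field; rewrite gt_eqF. Qed.

(** Square of [N * s ^+ N * (1 - s) <= 1], which compares [s ^+ N] with each term of a geometric
    sum. *)
Lemma pow_decay N : (0 < N)%N -> N%:R * t ^+ N <= (N%:R * (1 - s) ^+ 2)^-1.
Proof.
move=> N0; have N0' : 0 < N%:R :> R by rewrite ltr0n.
have s1' : 0 < 1 - s by rewrite subr_gt0.
have h : N%:R * s ^+ N * (1 - s) <= 1.
  apply: (@le_trans _ _ ((1 - s) * \sum_(i < N) s ^+ i)).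
    rewrite mulrC ler_wpM2l ?(ltW s1') // -{1}[N]card_ord -mulr_natl -sumr_const.
    rewrite mulr1 mulr_suml; apply: ler_sum => i _; rewrite mul1r.
    by rewrite ler_wiXn2l ?(ltW s0) ?(ltW s1) // ltnW.
  have -> : (1 - s) * \sum_(i < N) s ^+ i = 1 - s ^+ N by rewrite -[RHS]opprB subrX1 -mulNr opprB.
  by rewrite gerBl exprn_ge0 ?(ltW s0).
rewrite -[leRHS]mul1r ler_pdivlMr ?mulr_gt0 ?exprn_gt0 // /t exprAC.
have -> : N%:R * (s ^+ N) ^+ 2 * (N%:R * (1 - s) ^+ 2) = (N%:R * s ^+ N * (1 - s)) ^+ 2 by ring.
by rewrite exprn_ile1 // !mulr_ge0 ?ler0n ?exprn_ge0 ?(ltW s0) ?(ltW s1').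
Qed.

Lemma lambert_series_le N : (0 < N)%N ->
  \sum_(1 <= n < N.+1) divsum n * t ^+ n
  <= K + (C / N.+1%:R + N%:R * t ^+ N) / (1 - t).
Proof.
move=> N0.
have tX1 n : (0 < n)%N -> 1 - t <= 1 - t ^+ n.
  by move=> n0; rewrite lerD2l lerN2 -{2}[t]expr1 ler_wiXn2l ?(ltW t0) ?(ltW t1).
have -> : \sum_(1 <= n < N.+1) divsum n * t ^+ n
  = \sum_(1 <= d < N.+1) \sum_(1 <= k < (N %/ d).+1) chi d * t ^+ (d * k).
  rewrite -(sum_divisor_pairs (fun d k => chi d * t ^+ (d * k))).
  apply: eq_bigr => n _; rewrite /divsum mulr_suml; apply: eq_bigr => d dn.
  by rewrite mulnC divnK.
(* [E d] is the tail of the geometric series in [t ^+ d] cut at [d * k <= N]. The rest splits by the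
   definition of [lambert] into the truncated [L(1, chi)], small by [chiC], and an Abel sum bounded
   by [K * lambert 1]. *)
pose E d := chi d * (t ^+ (d * (N %/ d).+1) / (1 - t ^+ d)).
have -> : \sum_(1 <= d < N.+1) \sum_(1 <= k < (N %/ d).+1) chi d * t ^+ (d * k)
  = (\sum_(1 <= d < N.+1) chi d / d%:R) / (1 - t)
    - \sum_(1 <= d < N.+1) chi d * lambert d - \sum_(1 <= d < N.+1) E d.
  rewrite mulr_suml -!sumrB; apply: eq_big_nat => d /andP[d0 _].
  rewrite -mulr_sumr; under eq_bigr do rewrite exprM.
  have td : 0 < 1 - t ^+ d by apply: lt_le_trans (tX1 d d0).
  have d0' : 0 < d%:R :> R by rewrite ltr0n.
  rewrite geometric_sum; last by rewrite lt_eqF // -subr_gt0.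
  by rewrite /E /lambert exprM; field; rewrite !gt_eqF.
have h1 : (\sum_(1 <= d < N.+1) chi d / d%:R) / (1 - t) <= C / N.+1%:R / (1 - t).
  by rewrite ler_pM2r ?invr_gt0 //; apply: le_trans (ler_norm _) (chiC N).
have h2 : - \sum_(1 <= d < N.+1) chi d * lambert d <= K.
  apply: le_trans (ler_norm _) _; rewrite normrN -[K]mulr1 -lambert1.
  apply: norm_sum_monotone => [k k1|n n1|n n1]; [exact: chiK | exact: lambert_decr | exact: lambert_ge0].
have h3 : - \sum_(1 <= d < N.+1) E d <= N%:R * t ^+ N / (1 - t).
  apply: le_trans (ler_norm _) _; rewrite normrN; apply: le_trans (ler_norm_sum _ _ _) _.
  have -> : N%:R * t ^+ N / (1 - t) = \sum_(1 <= d < N.+1) t ^+ N / (1 - t).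
    by rewrite sumr_const_nat subn1 /= -[RHS]mulr_natl mulrA.
  rewrite big_nat [leRHS]big_nat; apply: ler_sum => d /andP[d0 dN].
  have td : 0 < 1 - t ^+ d by apply: lt_le_trans (tX1 d d0).
  rewrite normrM; apply: (@le_trans _ _ (t ^+ (d * (N %/ d).+1) / (1 - t ^+ d))).
    rewrite (ger0_norm (_ : 0 <= t ^+ _ / _)) ?divr_ge0 ?exprn_ge0 ?(ltW s0) ?(ltW td) //.
    rewrite ler_piMl ?divr_ge0 ?exprn_ge0 ?(ltW s0) ?(ltW td) //.
    by case: (chi_sgn d) => ->; rewrite ?normrN ?normr1 ?normr0.
  apply: ler_pM; rewrite ?exprn_ge0 ?invr_ge0 ?(ltW s0) ?(ltW td) //.
    by rewrite ler_wiXn2l ?(ltW t0) ?(ltW t1) // mulnC ltnW // ltn_ceil.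
  by rewrite lef_pV2 ?posrE // tX1.
rewrite mulrDl addrA [K + _]addrC; exact: lerD (lerD h1 h2) h3.
Qed.
End Lambert.

Lemma real_character_contradiction : False.
Proof.
have K0 : 0 <= K by apply: le_trans (chiK (leqnn 0)); rewrite ?normr_ge0.
have C0 : 0 <= C.
  by have := chiC 0; rewrite divr1; apply: le_trans; exact: normr_ge0.
have [J [J0 hJ]] := natr_unbounded (2 * (K + 2)).
have J0' : 1 <= J%:R :> R by rewrite ler1n.
(* By Bernoulli, this [x] gives [(s ^+ 2) ^+ (J ^ 2) >= 1 / 2], so the [J] squares contribute at
   least [J / 2 > K + 2]. *)
pose x : R := (4 * J%:R ^+ 2)^-1; pose s := 1 - x.
have J2 : 1 <= J%:R ^+ 2 :> R by rewrite exprn_ege1.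
have x0 : 0 < x by rewrite invr_gt0; lra.
have ex : x * (4 * J%:R ^+ 2) = 1 by rewrite mulVf // gt_eqF //; lra.
have x4 : x <= 1 / 4.
  have : x * 1 <= x * J%:R ^+ 2 by rewrite ler_pM2l.
  lra.
have s01 : 0 < s < 1 by rewrite /s; lra.
have s1 : s < 1 by case/andP: s01.
have s0 : 0 < s by case/andP: s01.
have t1 : 0 < 1 - s ^+ 2 by rewrite subr_gt0 exprn_ilt1 // ltW.
(* [N] is taken large enough for the remainder to be at most [1], and at least [J ^ 2] so that all
   the squares occur. *)
have [n [n0 hn]] := natr_unbounded ((C + ((1 - s) ^+ 2)^-1) / (1 - s ^+ 2)).
pose N := maxn n (J ^ 2).
have N0 : (0 < N)%N by rewrite leq_max n0.
have N0' : 0 < N%:R :> R by rewrite ltr0n.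
have := lambert_series_le s01 N0.
have low : J%:R / 2 <= \sum_(1 <= n0 < N.+1) divsum n0 * (s ^+ 2) ^+ n0.
  apply: (@le_trans _ _ (\sum_(1 <= k < J.+1) divsum (k ^ 2) * (s ^+ 2) ^+ (k ^ 2))); last first.
    apply: (@sum_squares_le _ (fun n => divsum n * (s ^+ 2) ^+ n)).
      by move=> k k0; rewrite mulr_ge0 ?(divsum_bounds k0).1 // exprn_ge0 ?sqr_ge0.
    exact: leq_maxr.
  have -> : J%:R / 2 = \sum_(1 <= k < J.+1) (1 / 2 : R).
    by rewrite sumr_const_nat subn1 /= -[RHS]mulr_natl div1r.
  rewrite big_nat [leRHS]big_nat; apply: ler_sum => k /andP[k0 kJ].
  rewrite -[1 / 2]mul1r; apply: ler_pM; rewrite ?ler01 ?divsum_square ?divr_ge0 //.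
  apply: (@le_trans _ _ ((s ^+ 2) ^+ (J ^ 2))); last first.
    by rewrite ler_wiXn2l ?sqr_ge0 ?leq_exp2r // -subr_ge0 ltW.
  rewrite -exprM; apply: le_trans (bernoulli (2 * J ^ 2) _); last by lra.
  rewrite natrM natrX; lra.
have err : (C / N.+1%:R + N%:R * (s ^+ 2) ^+ N) / (1 - s ^+ 2) <= 1.
  apply: (@le_trans _ _ ((C + ((1 - s) ^+ 2)^-1) / (1 - s ^+ 2) / N%:R)); last first.
    rewrite ler_pdivrMr // mul1r; apply: le_trans (ltW hn) _.
    by rewrite ler_nat leq_maxl.
  rewrite [leRHS]mulrAC ler_pM2r ?invr_gt0 // mulrDl; apply: lerD.
    by rewrite ler_wpM2l // lef_pV2 ?posrE ?ltr0n // ler_nat.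
  by rewrite -invfM mulrC [X in _ <= X^-1]mulrC [X in X <= _]mulrC; apply: pow_decay.
move=> h; have := le_trans low (le_trans h (lerD (lexx K) err)); move: hJ; lra.
Qed.
End RealCharacter.

(** * Dirichlet's theorem *)

Section Nonvanishing.
Variables (R : realType) (m : nat) (a : {unit 'Z_m} -> R) (C0 : R).
Hypothesis m1 : (1 < m)%N.
Hypothesis C0_ge0 : 0 <= C0.
Hypothesis aP : forall g N,
  `|\sum_(1 <= n < N.+1) uext (centered R g) n / n%:R - a g| <= C0 / N.+1%:R.

Lemma null_trivial v x : null_fun a v -> v x = 0.
Proof.
move=> Vv; apply/eqP; apply: contraT => nz.
have [chi [Vchi chi1 chiM chi2]] := null_character m1 C0_ge0 aP Vv nz.
have [K HK] := uext_interval_bounded m1 Vchi.1.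
have [C C_ge0 HC] := kernel_op_tail C0_ge0 aP Vchi.1.
exfalso; apply: (@real_character_contradiction R (uext chi) K C) => [|n d|n|//|N].
- by rewrite /uext coprimen1 cls1.
- rewrite uext_mul // /uext; case: ifP => _; last by rewrite mul0r.
  by case: ifP => _; rewrite ?mulr0 // chiM.
- rewrite /uext; case: ifP => _; last by constructor 1.
  have /eqP := chi2 (cls m n); rewrite sqrf_eq1 => /orP[]/eqP ->; by [constructor 2 | constructor 3].
(* [L chi] vanishing at [1] says [L(1, chi) = 0], and the tail bound supplies the rate. *)
- have := HC 1%g N; rewrite Vchi.2 subr0.
  by under eq_bigr => n _ do rewrite (_ : uext _ n = uext chi n) ?/uext ?mul1g //.
Qed.
End Nonvanishing.

Local Close Scope ring_scope.

Theorem dirichlet m a B : 0 < m -> coprime m a ->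
  exists p, [/\ prime p, B < p & p = a %[mod m]].
Proof.
(* ['Z_m] is the ring of residues modulo [m] only for [m > 1]; modulus [1] is Euclid's theorem. *)
move=> m0 ma; have [m1|] := ltnP 1 m; last first.
  case: m m0 ma => [|[|m]] // _ _ _; have [p Bp pp] := prime_above B.
  by exists p; split; rewrite ?modn1.
apply: contrapT => nex.
have few n : prime n -> coprime m n && (cls m n == cls m a) -> n <= B.
  move=> pn /andP[mn /eqP e]; rewrite leqNgt; apply/negP => Bn; apply: nex.
  by exists n; split=> //; apply: cls_inj e.
have [k [C0 [C0_ge0 kP]]] := exists_kernel Rdefinitions.R m1.
have [N [N0]] := mangoldt_sum_delta_unbounded m1 C0_ge0 kP (cls m a) 
  (fun v Vv x => null_trivial m1 C0_ge0 kP x Vv)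
  (2 + \sum_(1 <= n < B.+1) mangoldt Rdefinitions.R n / n%:R)%R.
rewrite ltNge => /negP; apply; apply: le_trans (sum_mangoldt_few_primes Rdefinitions.R N few).
rewrite [leRHS]big_mkcond; apply: ler_sum => n _; rewrite /uext.
by case: (coprime m n) => /=; first case: (cls m n == cls m a); rewrite ?mul1r ?mul0r ?mulr0.
Qed.

(** * Covering the exponents *)

Lemma coprime_primeP m x : 0 < m -> (forall l, prime l -> l %| m -> ~~ (l %| x)) -> coprime m x.
Proof.
move=> m0 H; apply: contraT; rewrite /coprime => g1.
have g2 : 1 < gcdn m x by rewrite ltn_neqAle eq_sym g1 gcdn_gt0 m0.
have := H _ (pdiv_prime g2) (dvdn_trans (pdiv_dvd _) (dvdn_gcdl _ _)).
by rewrite (dvdn_trans (pdiv_dvd _) (dvdn_gcdr _ _)).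
Qed.

Lemma odd_prime_divisor x : 0 < x -> (forall k, x != 2 ^ k) ->
  exists l, [/\ prime l, odd l & l %| x].
Proof.
move=> x0 xk; have u1 : x`_2^' != 1.
  by apply: contraNneq (xk (logn 2 x)) => e; rewrite -{1}(partnC 2 x0) e muln1 p_part.
have u2 : 1 < x`_2^' by rewrite ltn_neqAle eq_sym u1 part_gt0.
exists (pdiv x`_2^'); split; first exact: pdiv_prime.
  have := dvdn_odd (pdiv_dvd x`_2^'); apply.
  by have := part_pnat 2^' x; rewrite p'natE // dvdn2 negbK.
exact: dvdn_trans (pdiv_dvd _) (dvdn_part _ _).
Qed.

(** Modulo [4] the left side is [1] or [2], so it could only be the power [1] or [2], too small for
    [y > 1]. *)
Lemma square_add1_not_pow2 y k : 1 < y -> y ^ 2 + 1 != 2 ^ k.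
Proof.
move=> y1; apply/eqP; case: k => [|[|k]]; rewrite ?expn0 ?expn1.
- by rewrite addn1 => -[] /eqP; rewrite expn_eq0; lia.
- by have : 2 ^ 2 <= y ^ 2; rewrite ?leq_exp2r //; lia.
rewrite (divn_eq y 4); have : y %% 4 < 4 by rewrite ltn_mod.
rewrite -[k.+2]addn2 expnD -mulnn.
by move: (y %/ 4) (y %% 4) (2 ^ k) => z [|[|[|[|w]]]] t // _; nia.
Qed.

Lemma dvdn_add1_odd_pow x o : odd o -> x + 1 %| x ^ o + 1.
Proof.
move=> oo; rewrite -(odd_double_half o) oo; elim: o./2 => [|k IH]; first by rewrite expn1.
case: x IH => [|x] IH; first by rewrite dvd1n.
have e : x.+1 ^ 2 * (x.+1 ^ (1 + k.*2) + 1) = x * (x.+1 + 1) + (x.+1 ^ (1 + k.+1.*2) + 1).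
  rewrite doubleS !addnS !expnS; nia.
by rewrite -(dvdn_addr (m := x * (x.+1 + 1))) ?dvdn_mull // -e dvdn_mull.
Qed.

Lemma sqr_modn1 l y : 0 < y -> l %| y + 1 -> y ^ 2 = 1 %[mod l].
Proof.
move=> y0 ly; apply/eqP; rewrite eqn_mod_dvd ?expn_gt0 ?y0 //.
by rewrite -[1%N](exp1n 2) subn_sqr dvdn_mull.
Qed.

Section Cover.
Variable q : nat.
Hypothesis q1 : 1 < q.

Lemma odd_prime_coprime l j : prime l -> odd l -> 0 < j -> l %| q ^ j + 1 ->
  ~~ (l %| q) /\ ~~ (l %| q.-1).
Proof.
move=> lp lo j0 lq; split; apply/negP => h.
  have : l %| q ^ j by rewrite dvdn_exp.
  by move=> lqj; move: lq; rewrite dvdn_addr // dvdn1 => /eqP e; rewrite e in lp.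
have h1 : l %| q ^ j - 1 by rewrite subn1 predn_exp dvdn_mulr.
have : l %| 2.
  rewrite -(dvdn_addr (m := q ^ j - 1)) //.
  by rewrite (_ : _ + 2 = q ^ j + 1) //; have := expn_gt0 q j; lia.
by rewrite dvdn_prime2 // => /eqP e; rewrite e in lo.
Qed.

Lemma pow2_levels_disjoint l i j : prime l -> odd l -> i < j ->
  l %| q ^ (2 ^ i) + 1 -> ~~ (l %| q ^ (2 ^ j) + 1).
Proof.
move=> lp lo ij li; apply/negP => lj.
have e : q ^ (2 ^ j) = 1 %[mod l].
  rewrite -(subnKC ij) expnD expnS [2 * _]mulnC !expnM -modnXm.
  by rewrite sqr_modn1 ?modnXm ?exp1n // expn_gt0 ltnW.
move: lj; rewrite /dvdn -modnDml e modnDml => l2.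
have : l %| 2 by [].
by rewrite dvdn_prime2 // => /eqP e2; rewrite e2 in lo.
Qed.

(** The primes dividing [m] form a covering system for the exponents of 2-adic valuation below [n];
    recording their levels keeps [m] prime to [q], [q.-1] and the primes of later levels. *)
Definition covers n m := [/\ 0 < m,
  forall l, prime l -> l %| m -> odd l /\ exists2 i, i < n & l %| q ^ (2 ^ i) + 1 &
  forall c, 0 < c -> ~~ (2 ^ n %| c) -> exists l, [/\ prime l, l %| m & l %| q ^ c + 1]].

(** The new exponents are [c = o * 2 ^ n] with [o] odd, for which [q ^ (2 ^ n) + 1] divides
    [q ^ c + 1]. *)
Lemma covers_step n m l : prime l -> odd l -> l %| q ^ (2 ^ n) + 1 ->
  covers n m -> covers n.+1 (m * l).
Proof.
move=> lp lo lq [m0 Hm Hc]; split; first by rewrite muln_gt0 m0 prime_gt0.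
  move=> k kp; rewrite Euclid_dvdM // => /orP[km|]; last rewrite dvdn_prime2 // => /eqP ->.
    have [ko [i i_n ki]] := Hm k kp km; split=> //; exists i => //; exact: ltnW.
  by split=> //; exists n.
move=> c c0 nc; have [dc|ndc] := boolP (2 ^ n %| c); last first.
  by have [k [kp km kq]] := Hc c c0 ndc; exists k; split; rewrite ?dvdn_mulr.
exists l; split; rewrite ?dvdn_mull //.
have [o ec] := dvdnP dc; have oo : odd o.
  apply: contraNT nc => no; rewrite ec expnS dvdn_mul // dvdn2 //.
rewrite ec mulnC expnM; exact: dvdn_trans lq (dvdn_add1_odd_pow _ oo).
Qed.

Lemma covers_exists n : (forall k, q.+1 != 2 ^ k) -> exists m, covers n m.
Proof.
move=> hq; elim: n => [|n [m Hm]].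
  exists 1; split=> // [l lp|c _]; last by rewrite dvd1n.
  by rewrite dvdn1 => /eqP e; rewrite e in lp.
have [|l [lp lo lq]] := @odd_prime_divisor (q ^ (2 ^ n) + 1) (ltn_addl _ (isT : 0 < 1)).
  (* Level [0] is [q + 1], where the non-Mersenne hypothesis enters; higher levels are squares plus
     one. *)
  case: n Hm => [|n] _ k; first by rewrite expn1 addn1.
  rewrite expnS mulnC expnM square_add1_not_pow2 //.
  by rewrite -{1}(exp1n (2 ^ n)) ltn_exp2r // expn_gt0.
by exists (m * l); apply: covers_step.
Qed.

(** With [y = q ^ (2 ^ N.-1)], [l] divides [(y - 1) * (y + 1)] but not [y - 1] by minimality of the
    order. If [l = 2], then [q] is odd and has order [1]. *)
Lemma is_ord_pow2 l N : prime l -> 0 < N -> is_ord l q (2 ^ N) ->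
  odd l /\ l %| q ^ (2 ^ N.-1) + 1.
Proof.
move=> lp; case: N => // N _ [_ [h1 h2]] /=.
have y0 : 0 < q ^ (2 ^ N) by rewrite expn_gt0 ltnW.
have lt : 2 ^ N < 2 ^ N.+1 by rewrite ltn_exp2l.
have ly : l %| q ^ (2 ^ N) + 1.
  move/eqP: h1; rewrite expnS mulnC expnM eqn_mod_dvd ?expn_gt0 ?(ltnW q1) //.
  rewrite -[X in _ - X](exp1n 2) subn_sqr Euclid_dvdM // => /orP[h|//].
  have /h2 : 0 < 2 ^ N by rewrite expn_gt0.
  have /eqP e : q ^ (2 ^ N) == 1 %[mod l] by rewrite eqn_mod_dvd.
  by move/(_ e); rewrite leqNgt lt.
split=> //; apply: contraT => lo.
have el : l = 2 by case: (even_prime lp) => // h; rewrite h in lo.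
subst l; move: ly; rewrite dvdn2 oddD /= addbT negbK oddX expn_eq0 /= => qo.
have /(h2 1 isT) : q ^ 1 = 1 %[mod 2] by rewrite expn1 !modn2 qo.
by rewrite leqNgt -(expn0 2) ltn_exp2l.
Qed.
End Cover.

(** * Schemmel values and the residue class of [p] *)

Lemma schemmel_neq r p : prime r.+1 -> prime p -> r.+1 < p ->
  (forall c, p != r.+1 ^ c + r) -> (forall c, ~~ prime (r.+1 ^ c * p + r)) ->
  forall alpha, in_G r (r.+1 ^ alpha * p).
Proof.
move=> qp pp qltp pc npc alpha; have p0 := prime_gt0 pp.
have pos : 0 < r.+1 ^ alpha * p by rewrite muln_gt0 expn_gt0 p0.
split=> // -[n [n0 e]].
pose F l := if l <= r then 0 else l ^ (logn l n).-1 * (l - r).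
have eF : \prod_(l <- primes n) F l = r.+1 ^ alpha * p by [].
have Fdvd l : l \in primes n -> F l %| r.+1 ^ alpha * p.
  by move=> ln; rewrite -eF (big_rem l) //= dvdn_mulr.
have : p %| \prod_(l <- primes n) F l by rewrite eF dvdn_mull.
rewrite Euclid_dvd_prod // big_has => /hasP[l ln pF].
have lp : prime l by move: ln; rewrite mem_primes => /and3P[].
move: pF (Fdvd l ln); rewrite /F; case: leqP => [_ _|rl].
  by rewrite dvd0n gtn_eqF.
(* Either [l = p] with [p ^ 2] dividing [n], so that [p - r] is a power of [r.+1], or
   [l - r = t * p] with [t] a power of [r.+1]. *)
rewrite Euclid_dvdM // => /orP[|/dvdnP[t et]] dv.
  move: dv; rewrite Euclid_dvdX // dvdn_prime2 // => /andP[/eqP el v0]; subst l => dv.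
  have : p - r %| r.+1 ^ alpha.
    rewrite -(dvdn_pmul2r p0); apply: dvdn_trans dv.
    by rewrite mulnC dvdn_mul // dvdn_exp.
  move/(dvdn_pfactor _ _ qp) => [c _ ec].
  by have /eqP := pc c; apply; rewrite -ec subnK // ltnW.
have : t %| r.+1 ^ alpha.
  rewrite -(dvdn_pmul2r p0) -et; apply: dvdn_trans dv; exact: dvdn_mull.
move/(dvdn_pfactor _ _ qp) => [c _ ec].
by have := npc c; rewrite -ec -et subnK ?lp // ltnW.
Qed.

Lemma prime_not_dvdn_pred p : prime p -> ~~ (p %| p.-1).
Proof. by case: p => [|[|p]] // _; rewrite gtnNdvd. Qed.

Lemma eq_mod_dvdn_add d x y z : x = y %[mod d] -> (d %| x + z) = (d %| y + z).
Proof. by move=> e; rewrite /dvdn -modnDml e modnDml. Qed.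

(** For [c >= 2] the equality would make [q ^ 2] divide [q ^ c + q], hence [q]; the size condition
    settles [c <= 1]. *)
Lemma neq_shifted_power q p : 1 < q -> q ^ 2 %| p + 1 -> 2 * q < p ->
  forall c, p != q ^ c + q.-1.
Proof.
move=> q1 dq qp [|[|c]]; apply/eqP => e; first by move: e qp; rewrite expn0; lia.
  by move: e qp; rewrite expn1; lia.
move: dq; rewrite e -addnA addn1 prednK ?(ltnW q1) // dvdn_addr; last first.
  by rewrite -(addn2 c) expnD dvdn_mull.
by rewrite gtnNdvd ?(ltnW q1) // -{1}(expn1 q) ltn_exp2l.
Qed.

(* Multiplying [q ^ c * p + r] by [q] turns the conditions at [c] into conditions on [q ^ c.+1]
   that no longer depend on the level of the cover. *)
Lemma cover_not_prime r m l' N p : covers r.+1 N m -> 0 < r ->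
  prime l' -> ~~ (l' %| r.+1) -> r.+1 ^ (2 ^ N) = 1 %[mod l'] ->
  p = r * r.+1 %[mod m] -> l' %| p + r * r.+1 -> m < p -> l' < p ->
  forall c, ~~ prime (r.+1 ^ c * p + r).
Proof.
move=> [m0 Hm Hc] r0 lp' lq' o pm pl mp lp c; set q := r.+1 in Hm Hc lq' o pm pl *.
have big : p <= q ^ c * p + r.
  by apply: leq_trans (leq_addr _ _); rewrite leq_pmull // expn_gt0.
suff [l [l_prime l_lt lq l_dvd]] : exists l, [/\ prime l, l < p, ~~ (l %| q) & l %| q ^ c.+1 * p + r * q].
  apply/negP => cp; move: l_dvd.
  rewrite (_ : _ + _ = q * (q ^ c * p + r)); last by rewrite expnS mulnDr mulnA [q * r]mulnC.
  rewrite Euclid_dvdM // (negbTE lq) /= dvdn_prime2 // => /eqP e.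
  by move: big; rewrite -e leqNgt l_lt.
have [dc|ndc] := boolP (2 ^ N %| c.+1).
  exists l'; split=> //; have [k ->] := dvdnP dc.
  have e : q ^ (k * 2 ^ N) * p = p %[mod l'].
    by rewrite mulnC [k * _]mulnC expnM -modnMmr -modnXm o modnXm exp1n modnMmr muln1.
  by rewrite (eq_mod_dvdn_add _ e).
have [l [l_prime lm lq]] := Hc c.+1 isT ndc.
have [lo [i _ li]] := Hm l l_prime lm.
have [lnq _] := odd_prime_coprime (r0 : 1 < q) l_prime lo (expn_gt0 2 i) li.
exists l; split=> //; first by apply: leq_ltn_trans mp; apply: dvdn_leq.
have e : r * q = p %[mod l] by rewrite -[RHS](modn_dvdm p lm) pm modn_dvdm.
by rewrite addnC (eq_mod_dvdn_add _ e) -{1}[p]mul1n -mulnDl addnC dvdn_mulr.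
Qed.

Lemma residue_class_exists x q m l : prime l -> 0 < q -> ~~ (l %| x) -> coprime m x ->
  coprime m l -> coprime (m * l) (q ^ 2) ->
  exists a, [/\ coprime (m * l * q ^ 2) a, a = x %[mod m], l %| a + x & q ^ 2 %| a + 1].
Proof.
move=> lp q0 lx mx ml mlq; have l0 := prime_gt0 lp.
have q20 : 0 < q ^ 2 by rewrite expn_gt0 q0.
(* [l.-1 * x] and [(q ^ 2).-1] stand for [- x] and [- 1] in two Chinese remainder steps. *)
pose b := chinese m l x (l.-1 * x).
have bm : b = x %[mod m] by apply: chinese_modl.
have bl : b = l.-1 * x %[mod l] by apply: chinese_modr.
pose a := chinese (m * l) (q ^ 2) b (q ^ 2).-1.
have ab : a = b %[mod m * l] by apply: chinese_modl.
have aq : a = (q ^ 2).-1 %[mod q ^ 2] by apply: chinese_modr.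
have am : a = x %[mod m].
  by rewrite -(modn_dvdm a (dvdn_mulr l (dvdnn m))) ab modn_dvdm ?dvdn_mulr.
have al : a = l.-1 * x %[mod l].
  by rewrite -(modn_dvdm a (dvdn_mull m (dvdnn l))) ab modn_dvdm ?dvdn_mull.
exists a; split=> //.
- have cm : coprime m a by rewrite -coprime_modr am coprime_modr.
  have cl : coprime l a.
    rewrite -coprime_modr al coprime_modr prime_coprime // Euclid_dvdM // negb_or lx.
    by rewrite prime_not_dvdn_pred.
  have cq : coprime (q ^ 2) a by rewrite -coprime_modr aq coprime_modr coprimenP.
  by rewrite coprimeMl cq coprimeMl cm cl.
- by rewrite (eq_mod_dvdn_add _ al) addnC -mulSn prednK // dvdn_mulr.
- by rewrite (eq_mod_dvdn_add _ aq) addn1 prednK.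
Qed.

Theorem theorem2p1 (r : nat) (hr : 0 < r) (hprime : prime r.+1)
  (hnotMersenne : ~ (exists k, r.+2 = 2 ^ k))
  (hord : exists N p1 p2, 0 < N /\ prime p1 /\ prime p2 /\ p1 <> p2 /\
            is_ord p1 r.+1 (2 ^ N) /\ is_ord p2 r.+1 (2 ^ N)) :
  forall M, exists p, M < p /\ prime p /\
    (forall alpha, in_G r (r.+1 ^ alpha * p)).
Proof.
move=> B; have [N [p1 [l [N0 [p1p [lp [p1l [o1 o2]]]]]]]] := hord.
pose q := r.+1; have q1 : 1 < q by [].
have [p1o p1q] := is_ord_pow2 q1 p1p N0 o1.
have [lo lq] := is_ord_pow2 q1 lp N0 o2.
have nM k : q.+1 != 2 ^ k by apply/eqP => e; apply: hnotMersenne; exists k.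
(* The cover stops below level [N.-1], which is filled by [p1] itself; [l] has that same level, so
   it differs from all primes of the cover. *)
have [m0 cov0] := covers_exists q1 N.-1 nM.
have ml : coprime (m0 * p1) l.
  rewrite coprime_sym prime_coprime // Euclid_dvdM // (dvdn_prime2 lp p1p) negb_or.
  apply/andP; split; last by apply/eqP => e; apply: p1l.
  have [_ Hm0 _] := cov0; apply/negP => /(Hm0 _ lp) [_ [i iN li]].
  by have := pow2_levels_disjoint q1 lp lo iN li; rewrite lq.
have := covers_step p1p p1o p1q cov0; rewrite prednK //.
move: (m0 * p1) ml => m ml cov; have [m_gt0 Hm _] := cov.
have lrq : ~~ (l %| r * q).
  have [h1 h2] := odd_prime_coprime q1 lp lo (expn_gt0 2 _) lq.
  by rewrite Euclid_dvdM // negb_or h1 h2.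
have mrq : coprime m (r * q).
  apply: coprime_primeP => // k kp km; have [ko [i _ ki]] := Hm k kp km.
  have [h1 h2] := odd_prime_coprime q1 kp ko (expn_gt0 2 i) ki.
  by rewrite Euclid_dvdM // negb_or h1 h2.
have mlq : coprime (m * l) (q ^ 2).
  have c : coprime (m * l) (r * q) by rewrite coprimeMl mrq prime_coprime.
  by rewrite coprimeXr //; apply: coprime_dvdr c; rewrite dvdn_mull.
have [a [ca am al aq]] := residue_class_exists lp (ltnW q1) lrq mrq ml mlq.
have D0 : 0 < m * l * q ^ 2 by rewrite !muln_gt0 m_gt0 prime_gt0.
(* The lower bound combines all size requirements on [p]. *)
have [p [pp Bp pa]] := dirichlet (B + m + l + 2 * q) D0 ca.
have modd d : d %| m * l * q ^ 2 -> p = a %[mod d].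
  by move=> dD; rewrite -(modn_dvdm p dD) pa modn_dvdm.
have pm : p = r * q %[mod m] by rewrite modd // -mulnA dvdn_mulr.
have pl : l %| p + r * q by rewrite (eq_mod_dvdn_add _ (modd l _)) // mulnAC dvdn_mull.
have pq : q ^ 2 %| p + 1 by rewrite (eq_mod_dvdn_add _ (modd (q ^ 2) _)) // dvdn_mull.
have ineq : [/\ B < p, m < p, l < p & 2 * q < p].
  by move: Bp; clear; move=> Bp; split; apply: leq_ltn_trans Bp; lia.
have [ltB ltm ltl ltq] := ineq.
exists p; split=> //; split=> //; apply: schemmel_neq => //.
- by apply: leq_ltn_trans ltq; rewrite leq_pmull.
- exact: neq_shifted_power q1 pq ltq.
- have lnq : ~~ (l %| q) by move: lrq; rewrite Euclid_dvdM // negb_or => /andP[].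
  have [_ [o _]] := o2; exact: (cover_not_prime cov hr lp lnq o pm pl ltm ltl).
Qed.
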